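(* Let $\mathfrak{t}$ be a triangulation of the $\infty$-gon. (a) If $\mathfrak{t}$ is locally finite, then $\mathfrak{t}$ yields a cluster algebra structure on the whole coordinate ring $\mathbb{C}[\mathrm{Gr}(2,\pm\infty)]$, where the $\Delta^{i,i+1}$ for $i\in\mathbb{Z}$ are coefficients. (b) If $\mathfrak{t}$ has a fountain $k$, then $\mathfrak{t}$ yields a cluster algebra structure on the subalgebra of $\mathbb{C}[\mathrm{Gr}(2,\pm\infty)]$ generated by the Plücker coordinates $\{\Delta^{ij}\mid i<j\le k \text{ or } k\le i<j\}$, where the $\Delta^{i,i+1}$ for $i\in\mathbb{Z}$ are coefficients. (c) If $\mathfrak{t}$ has a split fountain with left-fountain $l$ and right-fountain $r$, then $\mathfrak{t}$ yields a cluster algebra structure on the subalgebra of $\mathbb{C}[\mathrm{Gr}(2,\pm\infty)]$ generated by the Plücker coordinates $\{\Delta^{ij}\mid i<j\le l \text{ or } l\le i<j\le r \text{ or } r\le i<j\}$, where the $\Delta^{i,i+1}$ for $i\in\mathbb{Z}$ as well as $\Delta^{lr}$ are coefficients.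
   Context: The $\infty$-gon is the line of integers $\mathbb{Z}$. An arc is a pair of integers $(m,n)$ with $m\le n-2$; a side is a pair $(n,n+1)$. Arcs $(i,j)$ and $(m,n)$ intersect if $i<m<j<n$ or $m<i<n<j$. A triangulation is a maximal set of pairwise non-intersecting arcs. A triangulation $\mathfrak{t}$ is locally finite if for every integer $n$ only finitely many arcs of $\mathfrak{t}$ have $n$ as an endpoint. An integer $n$ is a right-fountain (resp. left-fountain) of $\mathfrak{t}$ if $\mathfrak{t}$ contains infinitely many arcs of the form $(n,p)$ (resp. $(m,n)$), and a fountain if it is both. $\mathfrak{t}$ has a split fountain if it has a left-fountain $l$ and a right-fountain $r$ with $l\neq r$. Exchange quiver $Q_{\mathfrak{t}}$: an ice quiver with one frozen vertex for each side $(i,i+1)$, $i\in\mathbb{Z}$, and one mutable vertex for each arc in $\mathfrak{t}$. For every triple $i<j<k$ such that each of $(i,j),(j,k),(i,k)$ is an arc of $\mathfrak{t}$ or a side, there are arrows $(i,j)\to(i,k)\to(j,k)\to(i,j)$; all arrows between two frozen vertices are then discarded. There are no other arrows. In the split fountain case the vertex $(l,r)$ is also regarded as frozen. $\mathbb{C}[\mathrm{Gr}(2,\pm\infty)]$ is the quotient of the polynomial ring $\mathbb{C}[\Delta^{ij}\mid i,j\in\mathbb{Z},\ i<j]$ by the short Plücker relations $\Delta^{ij}\Delta^{kl}=\Delta^{ik}\Delta^{jl}+\Delta^{il}\Delta^{kj}$ for all $i<k<j<l$. The images of the $\Delta^{ij}$ are called Plücker coordinates. Cluster algebras of infinite rank: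 a seed is a pair $(Q,\{x_v\}_{v\in Q_0})$ where $Q$ is an ice quiver without loops or $2$-cycles, with countably many vertices, each incident with finitely many arrows, and the $x_v$ are algebraically independent elements freely generating a field. Mutation at a mutable vertex $v$ replaces $Q$ by its Fomin–Zelevinsky mutation at $v$ and $x_v$ by $x_v'$ determined by $x_v'x_v=\prod_{u}x_u^{\#\{u\to v\}}+\prod_{u}x_u^{\#\{v\to u\}}$. Only finite sequences of mutations are allowed. All elements of the sets occurring in seeds so obtained are the cluster variables; those at frozen vertices (which never change) are called coefficients. The cluster algebra is the algebra generated by all cluster variables, including coefficients (coefficients are not inverted). ''$\mathfrak{t}$ yields a cluster algebra structure on $R$'', for $R$ a subalgebra of the domain $\mathbb{C}[\mathrm{Gr}(2,\pm\infty)]$, means: the elements $\Delta^{ij}$, for $(i,j)$ an arc in $\mathfrak{t}$ or a side, are algebraically independent over $\mathbb{C}$ and generate the fraction field of $R$ over $\mathbb{C}$, and, taking $(Q_{\mathfrak{t}},\{\Delta^{ij}\})$ as initial seed with the stated coefficients as frozen variables, the $\mathbb{C}$-subalgebra of the fraction field of $R$ generated by all cluster variables (including coefficients) is equal to $R$. *)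

(* Defs.v *)
From HB Require Import structures.
From mathcomp Require Import all_boot all_order all_algebra.
From mathcomp Require Import finmap.
From mathcomp Require Import boolp classical_sets functions cardinality fsbigop.
From mathcomp Require Import monalg.

Set Implicit Arguments.
Unset Strict Implicit.
Unset Printing Implicit Defensive.

Import Order.TTheory GRing.Theory Num.Theory.
Local Open Scope classical_set_scope.
Local Open Scope ring_scope.
Local Open Scope quotient_scope.

(* The pairs [i < j] indexing Plücker coordinates; among them, the sides are
   the pairs [(n, n + 1)] and the arcs are all the others. *)
Definition chord := {p : int * int | p.1 < p.2}.

Definition src (a : chord) : int := (val a).1.
Definition tgt (a : chord) : int := (val a).2.

Definition mkchord (i j : int) (ij : i < j) : chord := exist _ (i, j) ij.

Definition is_arc : set chord := [set a | src a <= tgt a - 2].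
Definition is_side : set chord := [set a | tgt a = src a + 1].

Definition crossing (a b : chord) : Prop :=
  (src a < src b /\ src b < tgt a /\ tgt a < tgt b) \/
  (src b < src a /\ src a < tgt b /\ tgt b < tgt a).

Definition noncrossing (t : set chord) : Prop :=
  t `<=` is_arc /\ forall a b, t a -> t b -> ~ crossing a b.

Definition triangulation (t : set chord) : Prop :=
  noncrossing t /\ forall t', noncrossing t' -> t `<=` t' -> t' = t.

Definition locally_finite (t : set chord) : Prop :=
  forall n, finite_set [set a | t a /\ (src a = n \/ tgt a = n)].

Definition right_fountain (t : set chord) (n : int) : Prop :=
  infinite_set [set a | t a /\ src a = n].

Definition left_fountain (t : set chord) (n : int) : Prop :=
  infinite_set [set a | t a /\ tgt a = n].

Definition fountain (t : set chord) (n : int) : Prop :=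
  left_fountain t n /\ right_fountain t n.

Record ice_quiver (V : Type) := IceQuiver {
  arrows : V -> V -> nat;
  frozen : set V
}.

Definition tri_vertex (t : set chord) := {a : chord | a \in t `|` is_side}.

(* [ij], [jk], [ik] are the sides of the triangle on some [i < j < k]. *)
Definition triangle (ij jk ik : chord) : Prop :=
  [/\ src ij = src ik, tgt ij = src jk & tgt jk = tgt ik].

(* Two sides of a triangle determine it, so there is at most one arrow from
   one vertex to another. [F] is the set of chords regarded as frozen. *)
Definition exchange_quiver (t F : set chord) : ice_quiver (tri_vertex t) :=
  {| arrows := fun u v =>
       `[< (exists ij jk ik : tri_vertex t,
              triangle (val ij) (val jk) (val ik) /\
              [\/ u = ij /\ v = ik, u = ik /\ v = jk | u = jk /\ v = ij]) /\
           ~ (F (val u) /\ F (val v)) >] : nat;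
     frozen := [set v | F (val v)] |}.

Section Algebra.
Variables (k : fieldType) (B : comNzRingType) (c : k -> B).

(* Subalgebras of [B], seen as a [k]-algebra through its structure map [c]. *)
Definition is_subalgebra (S : set B) : Prop :=
  [/\ forall a, S (c a), forall x y, S x -> S y -> S (x + y)
    & forall x y, S x -> S y -> S (x * y)].

Definition gen_subalgebra (G : set B) : set B := smallest is_subalgebra G.

Definition monomial_eval (V : choiceType) (x : V -> B) (m : {cmonom V}) : B :=
  \prod_(v <- finsupp m) x v ^+ m v.

Definition alg_independent (V : choiceType) (x : V -> B) : Prop :=
  forall p : {malg k[{cmonom V}]}, mmap c (monomial_eval x) p = 0 -> p = 0.

End Algebra.

Section Cluster.
Variables (k K : fieldType) (c : k -> K) (V : countType).

Definition is_subfield (S : set K) : Prop :=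
  is_subalgebra c S /\ forall x, S x -> S x^-1.

Definition gen_subfield (G : set K) : set K := smallest is_subfield G.

Record seed := Seed { quiver : ice_quiver V; cluster : V -> K }.

Definition is_ice_quiver (Q : ice_quiver V) : Prop :=
  [/\ forall v, arrows Q v v = 0%N,
      forall u v, arrows Q u v = 0%N \/ arrows Q v u = 0%N
    & forall v, finite_set [set u | arrows Q u v != 0%N \/ arrows Q v u != 0%N]].

(* [L] is the field freely generated by the cluster. *)
Definition is_seed (L : set K) (s : seed) : Prop :=
  [/\ is_ice_quiver (quiver s), alg_independent c (cluster s)
    & gen_subfield (range (cluster s)) = L].

(* For every path [i -> v -> j] an arrow [i -> j] is added, the arrows at [v]
   are reversed, and 2-cycles are cancelled by the truncated subtraction. *)
Definition mutate_arrows (q : V -> V -> nat) (v i j : V) : nat :=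
  (if (i == v) || (j == v) then q j i
   else (q i j + q i v * q v j) - (q j i + q j v * q v i))%N.

Definition mutate_quiver (Q : ice_quiver V) (v : V) : ice_quiver V :=
  {| arrows := mutate_arrows (arrows Q) v; frozen := frozen Q |}.

Definition exchange (s : seed) (v : V) : K :=
  let q := arrows (quiver s) in let x := cluster s in
  (\big[*%R/1]_(u \in [set: V]) x u ^+ q u v +
   \big[*%R/1]_(u \in [set: V]) x u ^+ q v u) / x v.

Definition mutate (s : seed) (v : V) : seed :=
  {| quiver := mutate_quiver (quiver s) v;
     cluster := fun u => if u == v then exchange s v else cluster s u |}.

Inductive mutation_equivalent (s0 : seed) : seed -> Prop :=
| MutationRefl : mutation_equivalent s0 s0
| MutationStep s v : mutation_equivalent s0 s -> ~ frozen (quiver s) v ->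
    mutation_equivalent s0 (mutate s v).

Definition cluster_variables (s0 : seed) : set K :=
  [set z | exists2 s, mutation_equivalent s0 s & range (cluster s) z].

Definition cluster_algebra (s0 : seed) : set K :=
  gen_subalgebra c (cluster_variables s0).

End Cluster.

Section Grassmannian.
Variable k : fieldType.

Local Notation plucker_poly := {malg k[{cmonom chord}]}.

Definition plucker_var (a : chord) : plucker_poly := << ucm a >>.

Definition plucker_relation (i m j l : int)
    (im : i < m) (mj : m < j) (jl : j < l) : plucker_poly :=
  let ij := lt_trans im mj in
  let ml := lt_trans mj jl in
  let il := lt_trans ij jl in
  let X (a b : int) (ab : a < b) := plucker_var (mkchord ab) in
  X i j ij * X m l ml - (X i m im * X j l jl + X i l il * X m j mj).

Definition plucker_relations : set plucker_poly :=
  [set p | exists i m j l (im : i < m) (mj : m < j) (jl : j < l),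
     p = plucker_relation im mj jl].

Definition is_ideal (S : set plucker_poly) : Prop :=
  [/\ S 0, forall x y, S x -> S y -> S (x + y)
    & forall x y, S y -> S (x * y)].

Definition plucker_ideal : {pred plucker_poly} :=
  fun p => `[< smallest is_ideal plucker_relations p >].

Lemma smallest_plucker_is_ideal :
  is_ideal (smallest is_ideal plucker_relations).
Proof.
split=> [|x y Sx Sy|x y Sy] S SP.
- by case: SP => -[].
- by have [[_ SD _] _] := SP; apply: SD; [apply: Sx | apply: Sy].
- by have [[_ _ SM] _] := SP; apply: SM; apply: Sy.
Qed.

Lemma plucker_relation_coef1 p : plucker_relations p -> p@_mone = 0.
Proof.
have X0 a : (plucker_var a)@_mone = 0.
  rewrite mcoeffU1; case: eqP => // /(congr1 (fun m => mdeg m)).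
  by rewrite mdegU mdeg1.
have XY0 a (y : plucker_poly) : (plucker_var a * y)@_mone = 0.
  move: (plucker_var a) (X0 a) => x x0.
  by rewrite (mcoeff1g_is_multiplicative _ _).1 x0 mul0r.
have BD0 (x y z : plucker_poly) : x@_mone = 0 -> y@_mone = 0 -> z@_mone = 0 ->
    (x - (y + z))@_mone = 0.
  by move=> x0 y0 z0; rewrite mcoeffB mcoeffD x0 y0 z0 addr0 subr0.
by move=> [i [m [j [l [im [mj [jl ->]]]]]]]; apply: BD0; exact: XY0.
Qed.

Lemma plucker_ideal_idealr : idealr_closed plucker_ideal.
Proof.
have [S0 SD SM] := smallest_plucker_is_ideal.
split; first exact/asboolP.
- apply/negP => /asboolP /(_ [set p | p@_mone = 0]) /=.
  rewrite mcoeff1 eqxx => h; suff /eqP : (1 : k) = 0 by rewrite oner_eq0.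
  apply: h; split; last exact: plucker_relation_coef1.
  split=> [|x y /= x0 y0|x y /= y0]; first exact: mcoeff0.
    by rewrite mcoeffD x0 y0 addr0.
  by rewrite (mcoeff1g_is_multiplicative _ _).1 y0 mulr0.
- move=> a u v /asboolP Iu /asboolP Iv; apply/asboolP.
  by apply: SD => //; exact: SM.
Qed.

HB.instance Definition _ :=
  isIdealr.Build plucker_poly plucker_ideal plucker_ideal_idealr.

(* The coordinate ring of Gr(2, ±oo). *)
Definition Gr2 := {ideal_quot plucker_ideal}.

Definition plucker (a : chord) : Gr2 :=
  \pi_{ideal_quot plucker_ideal} (plucker_var a).

(* The structure map of the [k]-algebra [Gr2]. *)
Definition Gr2_scalar (c : k) : Gr2 := \pi_{ideal_quot plucker_ideal} (c%:MP).

Definition plucker_subalgebra (P : set chord) : set Gr2 :=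
  gen_subalgebra Gr2_scalar (plucker @` P).

Definition is_fraction_field (K : fieldType) (iota : {rmorphism Gr2 -> K}) :
    Prop :=
  injective iota /\ forall z, exists a b, b != 0 /\ z = iota a / iota b.

(* The fraction field of the subalgebra [S] of [Gr2], as a subfield of that of
   [Gr2]. *)
Definition sub_fraction_field (K : fieldType) (iota : Gr2 -> K) (S : set Gr2) :
    set K :=
  [set z | exists a b, [/\ S a, S b, b != 0 & z = iota a / iota b]].

Definition initial_seed (K : fieldType) (iota : Gr2 -> K) (t F : set chord) :
    seed K (tri_vertex t) :=
  {| quiver := exchange_quiver t F;
     cluster := fun v => iota (plucker (val v)) |}.

(* The triangulation [t] yields a cluster algebra structure on [S], with the
   Plücker coordinates indexed by [F] as coefficients. That [Gr2] is a domain
   is part of the claim, through the existence of its fraction field. *)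
Definition yields_cluster_structure (t F : set chord) (S : set Gr2) : Prop :=
  exists (K : fieldType) (iota : {rmorphism Gr2 -> K}),
    let c := iota \o Gr2_scalar in
    let s := initial_seed iota t F in
    [/\ is_fraction_field iota,
        is_seed c (sub_fraction_field iota S) s
      & cluster_algebra c s = iota @` S].

End Grassmannian.

Arguments plucker_subalgebra k P : clear implicits.

(* Main.v *)
Require Import Defs.
From HB Require Import structures.
From mathcomp Require Import all_boot all_order all_algebra.
From mathcomp Require Import finmap.
From mathcomp Require Import boolp classical_sets functions cardinality fsbigop.
From mathcomp Require Import monalg reals.
From mathcomp Require Import complex.
From mathcomp Require Import zify ring.

Set Implicit Arguments.
Unset Strict Implicit.
Unset Printing Implicit Defensive.

Import Order.TTheory GRing.Theory Num.Theory.
Local Open Scope classical_set_scope.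
Local Open Scope ring_scope.
Local Open Scope quotient_scope.

(** A triangulation [t] together with all sides is a maximal noncrossing set of
    chords. The theorem has an algebraic half, about monomials in pairwise
    noncrossing chords, and a combinatorial half, about flips.

    Algebra. The noncrossing monomials form a basis of Gr(2, oo). They span it
    because the short Pluecker relations replace a crossing pair by the two
    pairs of opposite sides of its quadrilateral, which lowers [cross_deg]
    ([straightening]). They are independent because the substitution
    [x_i = 'X^(N ^ a_i)], [y_i = 'X^(N ^ b_i)] turns the minors
    [x_i y_j - x_j y_i] into monic polynomials and, for [N] large, gives
    different noncrossing monomials different degrees ([nc_independent]): the
    degree, read in base [N], shows how many chords start and how many end at
    each integer, and like a bracketing, a noncrossing multiset of chords can
    be recovered from its openings and closings ([nc_monomial_inj]). So the
    maps to k[X] detect the nonzero elements of Gr(2, oo), which is therefore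
    a domain ([Gr2_domain]), and any noncrossing set of Pluecker coordinates is
    algebraically independent ([plucker_alg_independent]).

    Combinatorics. Let the region of [t] consist of the chords that do not pass
    over a left- or right-fountain, and let its bridges be the chords from a
    left-fountain to a right-fountain. If an arc or side [e] of [t] does not lie
    under another arc of [t], then its left end is a left-fountain and its
    right end a right-fountain ([uncovered_left], [uncovered_right]). Hence
    every arc of [t] that is not a bridge lies in a triangle on either side and can be
    flipped, and this remains so after any number of flips
    ([flippable_flip]). A flip realizes a mutation: the exchange relation is a
    short Pluecker relation, and the mutated quiver is the exchange quiver of
    the flipped triangulation ([represents_mutate]). All cluster variables are
    thus Pluecker coordinates of chords in the region. Conversely a chord [c]
    of the region crosses only finitely many chords of [t], and as long as it
    crosses some, there is one of them whose flip is an arc with an end in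
    common with [c] ([approaching_flip]); so finitely many flips produce [c].
    Every triangulation therefore yields a cluster structure on the subalgebra
    generated by its region, with the sides and the bridges as coefficients
    ([triangulation_cluster_structure]). As there is at most one left-fountain
    and at most one right-fountain, the region and the bridges are easily found
    in each of the three cases. *)

(** * Chords and monomials *)

Lemma chord_lt (a : chord) : src a < tgt a.
Proof. exact: valP a. Qed.

Lemma chord_inj (a b : chord) : src a = src b -> tgt a = tgt b -> a = b.
Proof.
by case: a b => [[a1 a2] pa] [[b1 b2] pb]; rewrite /src /tgt /= => ea eb;
   apply: val_inj; rewrite /= ea eb.
Qed.

Lemma crossing_sym a b : crossing a b -> crossing b a.
Proof. by case; [right | left]. Qed.

Section WeightedDegree.
Context {V : choiceType} (w : V -> nat).
Implicit Types m : {cmonom V}.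

Definition wdeg m := (\sum_(v <- finsupp m) m v * w v)%N.

Lemma wdegEw m (d : {fset V}) : (finsupp m `<=` d)%fset ->
  wdeg m = (\sum_(v <- d) m v * w v)%N.
Proof.
move=> le; rewrite /wdeg (big_fset_incl _ le) // => v _.
by rewrite -cmE_neq0 negbK => /eqP ->.
Qed.

Lemma wdegU v : wdeg (ucm v) = w v.
Proof. by rewrite /wdeg mdomU big_seq_fset1 cmUU mul1n. Qed.

Lemma wdegM m1 m2 : wdeg (mmul m1 m2) = (wdeg m1 + wdeg m2)%N.
Proof.
rewrite (@wdegEw (mmul m1 m2) (finsupp m1 `|` finsupp m2)%fset) ?mdomD ?fsubset_refl//.
rewrite (wdegEw (fsubsetUl _ (finsupp m2))) (wdegEw (fsubsetUr (finsupp m1) _)).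
by rewrite -big_split /=; apply: eq_bigr => v _; rewrite cmM mulnDl.
Qed.

End WeightedDegree.

Section MonomialEval.
Variables (V : choiceType) (B : comNzRingType) (x : V -> B).

Lemma monomial_evalEw (m : {cmonom V}) (d : {fset V}) : (finsupp m `<=` d)%fset ->
  monomial_eval x m = \prod_(v <- d) x v ^+ m v.
Proof.
move=> le; rewrite /monomial_eval (big_fset_incl _ le) // => v _.
by rewrite -cmE_neq0 negbK => /eqP ->; rewrite expr0.
Qed.

Lemma monomial_eval_mmorphism : mmorphism (monomial_eval x).
Proof.
split=> [m1 m2|]; last by rewrite /monomial_eval mdom1 big_seq_fset0.
rewrite (@monomial_evalEw (mmul m1 m2) (finsupp m1 `|` finsupp m2)%fset) ?mdomD ?fsubset_refl//.
rewrite (monomial_evalEw (fsubsetUl _ (finsupp m2))).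
rewrite (monomial_evalEw (fsubsetUr (finsupp m1) _)) -big_split /=.
by apply: eq_bigr => v _; rewrite cmM exprD.
Qed.

HB.instance Definition _ :=
  isMultiplicative.Build {cmonom V} B (monomial_eval x) monomial_eval_mmorphism.

Lemma monomial_evalU v : monomial_eval x (ucm v) = x v.
Proof. by rewrite /monomial_eval mdomU big_seq_fset1 cmUU expr1. Qed.

End MonomialEval.

Lemma rmorph_monomial_eval (V : choiceType) (B C : comNzRingType)
    (f : {rmorphism B -> C}) (x : V -> B) m :
  f (monomial_eval x m) = monomial_eval (f \o x) m.
Proof.
rewrite /monomial_eval rmorph_prod; apply: eq_bigr => v _.
by rewrite rmorphXn.
Qed.

Lemma rmorph_mmap (k : nzRingType) (V : choiceType) (B C : comNzRingType)
    (f : {rmorphism B -> C}) (c : k -> B) (x : V -> B) (p : {malg k[{cmonom V}]}) :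
  f (mmap c (monomial_eval x) p) = mmap (f \o c) (monomial_eval (f \o x)) p.
Proof.
rewrite /mmap rmorph_sum; apply: eq_bigr => m _.
by rewrite rmorphM /= rmorph_monomial_eval.
Qed.

(** * Independence of the noncrossing monomials *)

Definition nc_monomial (V : choiceType) (e : V -> chord) (m : {cmonom V}) :=
  forall u v, u \in finsupp m -> v \in finsupp m -> ~ crossing (e u) (e v).

Lemma sum_lt_exchange (V : choiceType) (d : {fset V}) (P : pred V) (f g : V -> nat) v :
  v \in d -> P v -> (g v < f v)%N ->
  (\sum_(u <- d | P u) f u = \sum_(u <- d | P u) g u)%N ->
  exists u, [/\ P u, u != v & (f u < g u)%N].
Proof.
move=> vd Pv gf eq_sum; apply: contrapT => nex.
have le u : P u -> (g u <= f u)%N.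
  move=> Pu; case: (eqVneq u v) => [->|uv]; first exact: ltnW.
  by rewrite leqNgt; apply/negP => lt; apply: nex; exists u.
move: eq_sum; rewrite big_mkcond [RHS]big_mkcond (big_fsetD1 v) //=.
rewrite [RHS](big_fsetD1 v) //= Pv => eq_sum.
have : (\sum_(u <- (d `\ v)%fset) (if P u then g u else 0) <=
        \sum_(u <- (d `\ v)%fset) (if P u then f u else 0))%N.
  by apply: leq_sum => u _; case: ifP => // /le.
by lia.
Qed.

(** Let [v] be a shortest chord on which [m] and [m'] differ, with the larger
    multiplicity in [m], say. Since the totals at both ends of [v] agree, [m']
    has more of some other chord at either end; these two chords are longer than
    [v], so they cross each other. *)
Lemma nc_monomial_inj (V : choiceType) (e : V -> chord) (m m' : {cmonom V})
    (d : {fset V}) : injective e ->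
  nc_monomial e m -> nc_monomial e m' ->
  (finsupp m `<=` d)%fset -> (finsupp m' `<=` d)%fset ->
  {in d, forall v, (\sum_(u <- d | src (e u) == src (e v)) m u =
    \sum_(u <- d | src (e u) == src (e v)) m' u)%N} ->
  {in d, forall v, (\sum_(u <- d | tgt (e u) == tgt (e v)) m u =
    \sum_(u <- d | tgt (e u) == tgt (e v)) m' u)%N} ->
  m = m'.
Proof.
move=> e_inj.
have key (n n' : {cmonom V}) (l : int) v : nc_monomial e n' ->
    {in d, forall v, (\sum_(u <- d | src (e u) == src (e v)) n u =
      \sum_(u <- d | src (e u) == src (e v)) n' u)%N} ->
    {in d, forall v, (\sum_(u <- d | tgt (e u) == tgt (e v)) n u =
      \sum_(u <- d | tgt (e u) == tgt (e v)) n' u)%N} ->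
    (forall u, tgt (e u) - src (e u) < l -> n u = n' u) ->
    tgt (e v) - src (e v) = l -> v \in d -> (n v <= n' v)%N.
  move=> nc' es et IH vl vd; rewrite leqNgt; apply/negP => lt.
  have [u [/eqP us uv un]] :=
    @sum_lt_exchange _ d (fun u => src (e u) == src (e v)) _ _ v vd (eqxx _) lt (es v vd).
  have [w [/eqP wt wv wn]] :=
    @sum_lt_exchange _ d (fun u => tgt (e u) == tgt (e v)) _ _ v vd (eqxx _) lt (et v vd).
  have ul : l <= tgt (e u) - src (e u).
    by rewrite leNgt; apply/negP => /IH eu; rewrite eu ltnn in un.
  have wl : l <= tgt (e w) - src (e w).
    by rewrite leNgt; apply/negP => /IH ew; rewrite ew ltnn in wn.
  have tuv : tgt (e u) <> tgt (e v).
    by move=> eq; case/eqP: uv; apply: e_inj; apply: chord_inj.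
  have swv : src (e w) <> src (e v).
    by move=> eq; case/eqP: wv; apply: e_inj; apply: chord_inj.
  have lv := chord_lt (e v).
  apply: (nc' w u); [rewrite -cmE_neq0; lia | rewrite -cmE_neq0; lia |].
  by left; lia.
move=> nc nc' sd sd' es et; apply/eqP/cmP.
suff IH (l : nat) : forall v, tgt (e v) - src (e v) < l%:Z -> m v = m' v.
  by move=> v; apply: (IH `|tgt (e v) - src (e v)|.+1%N); have := chord_lt (e v); lia.
elim: l => [v|l IH v lv]; first by have := chord_lt (e v); lia.
case: (ltP (tgt (e v) - src (e v)) l%:Z) => [|lv']; first exact: IH.
have [vd|vd] := boolP (v \in d); last first.
  have /eqP -> : m v == 0%N by rewrite cmE_eq0; apply: contra vd => /(fsubsetP sd).
  by apply/eqP; rewrite eq_sym cmE_eq0; apply: contra vd => /(fsubsetP sd').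
have ll : tgt (e v) - src (e v) = l%:Z by lia.
apply/eqP; rewrite eqn_leq; apply/andP; split.
  by apply: key ll vd => //.
(* The same with the two monomials exchanged. *)
apply: key ll vd => //.
- by move=> u ud; rewrite es.
- by move=> u ud; rewrite et.
- by move=> u ul; rewrite IH.
Qed.

Lemma digits_inj B (f g : nat -> nat) S :
  (forall s, (f s < B)%N) -> (forall s, (g s < B)%N) ->
  (\sum_(s < S) f s * B ^ s = \sum_(s < S) g s * B ^ s)%N ->
  forall s, (s < S)%N -> f s = g s.
Proof.
elim: S f g => // S IH f g fB gB.
rewrite !big_ord_recl !expn0 !muln1.
have shift (h : nat -> nat) : (\sum_(i < S) h (lift ord0 i) * B ^ (lift ord0 i)  =
    (\sum_(i < S) (h i.+1) * B ^ i) * B)%N.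
  by rewrite big_distrl; apply: eq_bigr => i _; rewrite /= /bump /= add1n expnS; lia.
rewrite !shift => eq.
have eq0 : f 0%N = g 0%N.
  have := congr1 (modn^~ B) eq; rewrite /= ![(_ + _ * B)%N]addnC !modnMDl.
  by rewrite !modn_small.
have eqS : (\sum_(i < S) (f i.+1) * B ^ i = \sum_(i < S) (g i.+1) * B ^ i)%N.
  have B0 : (0 < B)%N by apply: leq_ltn_trans (fB 0%N).
  by apply/eqP; rewrite -(eqn_pmul2r B0); move: eq; rewrite eq0 => /addnI ->.
case=> // s sS; exact: (IH (fun s => f s.+1) (fun s => g s.+1)).
Qed.

Section Evaluation.
Variable k : fieldType.
Local Notation plucker_poly := {malg k[{cmonom chord}]}.

Lemma rmorph_plucker_relation (C : comNzRingType) (f : {rmorphism plucker_poly -> C})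
    (D : chord -> C) (i m j l : int) (im : i < m) (mj : m < j) (jl : j < l) :
  (forall a, f (plucker_var k a) = D a) ->
  f (plucker_relation k im mj jl) =
  D (mkchord (lt_trans im mj)) * D (mkchord (lt_trans mj jl)) -
  (D (mkchord im) * D (mkchord jl) +
   D (mkchord (lt_trans (lt_trans im mj) jl)) * D (mkchord mj)).
Proof.
rewrite /plucker_relation /=; move: (plucker_var k) => X fX; rewrite -!fX.
by rewrite rmorphB rmorphD; congr (_ - (_ + _)); apply: rmorphM.
Qed.

(** Places in base [N] for the generic 2 x oo matrix: the [x_i] get even and the
    [y_i] odd places, increasing with [i] from [i = - N] on. *)
Definition x_place (N : nat) (i : int) : nat := (2 * `|(i + N%:Z)%R|)%N.
Definition y_place (N : nat) (i : int) : nat := (2 * `|(i + N%:Z)%R|).+1%N.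

(** The minor [x_i y_j - x_j y_i] for [x_i = 'X^(N ^ x_place N i)] and [y_i =
    'X^(N ^ y_place N i)]. *)
Definition Kronecker_minor (N : nat) (a : chord) : {poly k} :=
  'X^(N ^ x_place N (src a)) * 'X^(N ^ y_place N (tgt a)) -
  'X^(N ^ x_place N (tgt a)) * 'X^(N ^ y_place N (src a)).

Definition Kronecker_eval (N : nat) : plucker_poly -> {poly k} :=
  mmap (@polyC k) (monomial_eval (Kronecker_minor N)).

HB.instance Definition _ N := GRing.RMorphism.on (Kronecker_eval N).

Lemma Kronecker_eval_var N a : Kronecker_eval N (plucker_var k a) = Kronecker_minor N a.
Proof. by rewrite /Kronecker_eval mmapU mul1r monomial_evalU. Qed.

Lemma Kronecker_eval_plucker_ideal N p :
  smallest (@is_ideal k) (@plucker_relations k) p -> Kronecker_eval N p = 0.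
Proof.
move=> /(_ [set p | Kronecker_eval N p = 0]); apply; split.
  split=> [|x y /= x0 y0|x y /= y0] /=.
  - by rewrite rmorph0.
  - by rewrite rmorphD /= x0 y0 addr0.
  - by rewrite rmorphM /= y0 mulr0.
move=> q [i [m [j [l [im [mj [jl ->]]]]]]] /=.
rewrite [LHS](rmorph_plucker_relation _ _ _ (Kronecker_eval_var N)).
by rewrite /Kronecker_minor /=; ring.
Qed.

Definition Kronecker_deg N (a : chord) : nat :=
  (N ^ x_place N (src a) + N ^ y_place N (tgt a))%N.

Definition in_window (N : nat) (i : int) := (`|i| <= N)%N.

(** The exponent of [y_i] is [N] times that of [x_i], so [x_i y_j] has a larger
    degree than [x_j y_i] if [i < j]. *)
Lemma Kronecker_minor_lead N a : (1 < N)%N -> in_window N (src a) -> in_window N (tgt a) ->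
  Kronecker_minor N a \is monic /\ size (Kronecker_minor N a) = (Kronecker_deg N a).+1.
Proof.
move=> N1 ws wt; rewrite /Kronecker_minor /Kronecker_deg -!exprD.
set n := (_ + _)%N; set n' := (_ + _)%N.
have nn : (n' < n)%N.
  rewrite /n /n' /x_place /y_place !expnS.
  have : (N ^ (2 * `|(src a + N%:Z)%R|) < N ^ (2 * `|(tgt a + N%:Z)%R|))%N.
    by rewrite ltn_exp2l // ltn_pmul2l //; have := chord_lt a; move: ws wt; rewrite /in_window; lia.
  set x := (N ^ _)%N; set y := (N ^ _)%N => xy.
  have [z ->] : exists z, y = (x + z.+1)%N by exists (y - x.+1)%N; lia.
  by nia.
have lt : (size (- 'X^n' : {poly k})%R < size ('X^n : {poly k}))%N.
  by rewrite size_polyN !size_polyXn.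
rewrite monicE lead_coefDl // lead_coefXn eqxx; split=> //.
by rewrite size_polyDl // size_polyXn.
Qed.

Lemma monomial_eval_lead (V : choiceType) (x : V -> {poly k}) (w : V -> nat)
    (m : {cmonom V}) :
  {in finsupp m, forall v, x v \is monic /\ size (x v) = (w v).+1} ->
  monomial_eval x m \is monic /\ size (monomial_eval x m) = (wdeg w m).+1.
Proof.
rewrite /monomial_eval /wdeg => xw.
rewrite !big_seq; apply: (big_rec2 (fun p n => p \is monic /\ size p = n.+1)).
  by rewrite monic1 size_poly1.
move=> v p n vm [mp sp]; have [mx sx] := xw v vm.
have mX : x v ^+ m v \is monic by apply: monic_exp.
have := size_exp (x v) (m v); rewrite sx /= => sX.
have X0 : (0 < size (x v ^+ m v))%N by rewrite size_poly_gt0 monic_neq0.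
rewrite rpredM //; split=> //.
rewrite size_monicM // ?monic_neq0 // sp -(prednK X0) sX; lia.
Qed.

End Evaluation.

Lemma eventually_all (T : eqType) (s : seq T) (P : nat -> T -> Prop) :
  (forall x, x \in s -> exists N0, forall N, (N0 <= N)%N -> P N x) ->
  exists N0, forall N, (N0 <= N)%N -> forall x, x \in s -> P N x.
Proof.
elim: s => [|x s IH] H; first by exists 0%N.
have [N1 H1] := H x (mem_head _ _).
have [|N2 H2] := IH; first by move=> y ys; apply: H; rewrite inE ys orbT.
exists (N1 + N2)%N => N NN y; rewrite inE => /orP[/eqP ->|ys].
  by apply: H1; lia.
by apply: H2 => //; lia.
Qed.

Lemma exists_argmax (T : eqType) (s : seq T) (D : T -> nat) x : x \in s ->
  exists2 y, y \in s & forall z, z \in s -> (D z <= D y)%N.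
Proof.
elim: s x => // x s IH y _.
case: s IH => [|x' s] IH.
  by exists x; rewrite ?mem_head // => z; rewrite inE => /eqP ->.
have [u us uP] := IH x' (mem_head _ _).
case: (leqP (D x) (D u)) => xu.
  by exists u; [rewrite inE us orbT | move=> z; rewrite inE => /orP[/eqP ->|/uP]].
exists x; first by rewrite mem_head.
move=> z; rewrite inE => /orP[/eqP ->//|/uP]; lia.
Qed.

Section Independence.
Variables (k : fieldType) (V : choiceType) (e : V -> chord).
Hypothesis e_inj : injective e.
Implicit Types m : {cmonom V}.

(** The bounds under which the degree of the image of [m] in k[X] can be read in
    base [N] without carries. *)
Definition small_monomial N m :=
  (2 * mdeg m < N)%N /\
  {in finsupp m, forall v, in_window N (src (e v)) /\ in_window N (tgt (e v))}.

Definition digit N m s :=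
  wdeg (fun v => (x_place N (src (e v)) == s) + (y_place N (tgt (e v)) == s))%N m.

Lemma eventually_small m : exists N0, forall N, (N0 <= N)%N -> small_monomial N m.
Proof.
have [|N0 H] := @eventually_all _ (finsupp m) (fun N v =>
    in_window N (src (e v)) /\ in_window N (tgt (e v))).
  move=> v _; exists (`|src (e v)| + `|tgt (e v)|)%N => N.
  by rewrite /in_window; lia.
exists (N0 + (2 * mdeg m).+1)%N => N NN; split; first by lia.
by move=> v; apply: H; lia.
Qed.

Lemma digit_lt N m s : small_monomial N m -> (digit N m s < N)%N.
Proof.
case=> + _; apply: leq_ltn_trans; rewrite /digit /wdeg /mdeg big_distrr /=.
by apply: leq_sum => v _; rewrite mulnC leq_mul2r; apply/orP; right; do 2 case: (_ == s).
Qed.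

Lemma wdeg_digits N m : small_monomial N m ->
  wdeg (Kronecker_deg N \o e) m = (\sum_(s < (4 * N).+2) digit N m s * N ^ s)%N.
Proof.
case=> _ win; rewrite /digit /wdeg.
under [RHS]eq_bigr => s _ do rewrite big_distrl.
rewrite exchange_big /= !big_seq; apply: eq_bigr => v vm.
have [ws wt] := win v vm.
have pick r : (r < (4 * N).+2)%N -> (\sum_(s < (4 * N).+2) (r == s) * N ^ s = N ^ r)%N.
  move=> rS; rewrite (bigD1 (Ordinal rS)) //= eqxx mul1n big1 ?addn0 // => s.
  by rewrite -val_eqE /= eq_sym => /negbTE ->.
(* On the window [- N, N] the places are at most [2 * (2 * N) + 1]. *)
transitivity (\sum_(s < (4 * N).+2) (m v * ((x_place N (src (e v)) == s) * N ^ s) +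
    m v * ((y_place N (tgt (e v)) == s) * N ^ s)))%N.
  rewrite big_split /= -!big_distrr /= !pick /x_place /y_place; last 2 first.
  - by move: ws wt; rewrite /in_window; lia.
  - by move: ws wt; rewrite /in_window; lia.
  by rewrite -mulnDr.
by apply: eq_bigr => s _; rewrite -mulnDr -mulnDl mulnA.
Qed.

(** The digits of the degree count the chords of the monomial that start, at
    even places, and that end, at odd places, at a given integer. *)
Lemma nc_deg_inj N m m' : small_monomial N m -> small_monomial N m' ->
  nc_monomial e m -> nc_monomial e m' ->
  wdeg (Kronecker_deg N \o e) m = wdeg (Kronecker_deg N \o e) m' -> m = m'.
Proof.
move=> sm sm' nc nc'; rewrite !wdeg_digits // => eq.
have {}eq := digits_inj (fun s => digit_lt s sm) (fun s => digit_lt s sm') eq.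
pose d := (finsupp m `|` finsupp m')%fset.
have win v : v \in d -> in_window N (src (e v)) /\ in_window N (tgt (e v)).
  by rewrite in_fsetU => /orP[]; [apply: (proj2 sm) | apply: (proj2 sm')].
apply: (nc_monomial_inj (d := d) e_inj nc nc'); rewrite ?fsubsetUl ?fsubsetUr //.
- move=> v vd; have [ws wt] := win v vd.
  have digE (n : {cmonom V}) : (finsupp n `<=` d)%fset ->
      digit N n (x_place N (src (e v))) = (\sum_(u <- d | src (e u) == src (e v)) n u)%N.
    move=> nd; rewrite /digit (wdegEw _ nd) [RHS]big_mkcond !big_seq; apply: eq_bigr => u ud.
    have [ws' wt'] := win u ud.
    have -> : (y_place N (tgt (e u)) == x_place N (src (e v))) = false.
      by rewrite /x_place /y_place; lia.
    rewrite addn0; have -> :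
        (x_place N (src (e u)) == x_place N (src (e v))) = (src (e u) == src (e v)).
      by move: ws ws'; rewrite /x_place /in_window; lia.
    by case: ifP => _; rewrite ?muln1 ?muln0.
  rewrite -!digE ?fsubsetUl ?fsubsetUr //; apply: eq.
  by move: ws; rewrite /x_place /in_window; lia.
- move=> v vd; have [ws wt] := win v vd.
  have digE (n : {cmonom V}) : (finsupp n `<=` d)%fset ->
      digit N n (y_place N (tgt (e v))) = (\sum_(u <- d | tgt (e u) == tgt (e v)) n u)%N.
    move=> nd; rewrite /digit (wdegEw _ nd) [RHS]big_mkcond !big_seq; apply: eq_bigr => u ud.
    have [ws' wt'] := win u ud.
    have -> : (x_place N (src (e u)) == y_place N (tgt (e v))) = false.
      by rewrite /x_place /y_place; lia.
    rewrite add0n; have -> :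
        (y_place N (tgt (e u)) == y_place N (tgt (e v))) = (tgt (e u) == tgt (e v)).
      by move: wt wt'; rewrite /y_place /in_window; lia.
    by case: ifP => _; rewrite ?muln1 ?muln0.
  rewrite -!digE ?fsubsetUl ?fsubsetUr //; apply: eq.
  by move: wt; rewrite /y_place /in_window; lia.
Qed.

(** One monomial of [p] has a larger degree than all others, and a monic image,
    so its coefficient in [p] is the leading coefficient of the image of [p]. *)
Lemma nc_independent (p : {malg k[{cmonom V}]}) :
  (forall m, m \in msupp p -> nc_monomial e m) -> p != 0 ->
  exists N0, forall N, (N0 <= N)%N ->
    mmap (@polyC k) (monomial_eval (Kronecker_minor k N \o e)) p != 0.
Proof.
move=> nc p0.
have [|N0 small] := @eventually_all _ (msupp p) small_monomial.
  by move=> m _; apply: eventually_small.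
have [m0 m0p] : exists m, m \in msupp p.
  by apply/fset0Pn; rewrite msupp_eq0.
exists (N0 + 2)%N => N NN.
have {}small m : m \in msupp p -> small_monomial N m by apply: small; lia.
pose f := monomial_eval (Kronecker_minor k N \o e).
pose D := wdeg (Kronecker_deg N \o e).
have lead m : m \in msupp p -> f m \is monic /\ size (f m) = (D m).+1.
  move=> /small [_ win]; apply: monomial_eval_lead => v /win [ws wt].
  by apply: Kronecker_minor_lead => //; lia.
have [m mp mmax] := exists_argmax D m0p.
apply/eqP => /(congr1 (fun q : {poly k} => q`_(D m))).
rewrite coef0 /mmap coef_sum (big_fsetD1 m) //= coefCM.
have [mf sf] := lead m mp.
have -> : (f m)`_(D m) = 1 by move: mf; rewrite monicE /lead_coef sf /= => /eqP.
rewrite mulr1 big_seq big1 ?addr0.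
  by move/eqP; apply/negP; rewrite mcoeff_neq0.
move=> m'; rewrite in_fsetD1 => /andP[m'm m'p]; rewrite coefCM.
have [_ sf'] := lead m' m'p.
have le := mmax m' m'p.
have ne : D m' <> D m.
  move=> eq; case/eqP: m'm; apply: nc_deg_inj eq; first [exact: small | exact: nc].
by rewrite [X in _ * X]nth_default ?mulr0 // sf'; lia.
Qed.

End Independence.

(** * Straightening *)

Lemma fraction_numden (D : idomainType) (z : {fraction D}) :
  exists a b : D, b != 0 /\ z = FracField.tofrac a / FracField.tofrac b.
Proof.
elim/quotW: z => x; exists (frac x).1, (frac x).2; split; first exact: denom_ratioP.
have d0 := denom_ratioP x.
have dF0 : FracField.tofrac (frac x).2 != 0 by rewrite tofrac_eq0.
apply: (mulIf dF0); rewrite mulfVK //; unlock FracField.tofrac.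
rewrite -[LHS]FracField.pi_mul; apply/eqmodP => /=.
rewrite FracField.equivfE /FracField.mulf !numden_Ratio ?oner_eq0 ?mulf_neq0 ?oner_neq0 //.
by rewrite !mulr1 mulrC.
Qed.

(** Fractions are taken over an integral domain with given inverses of its
    units; on [B] these inverses come from classical choice. *)
Lemma domain_fraction_field (B : comNzRingType) :
  GRing.integral_domain_axiom B ->
  exists (K : fieldType) (iota : {rmorphism B -> K}),
    injective iota /\ forall z, exists a b, b != 0 /\ z = iota a / iota b.
Proof.
move=> domB.
pose unit : {pred B} := fun x => `[< exists y, y * x = 1 >].
pose inv (x : B) := if pselect (exists y, y * x = 1) is left h then projT1 (cid h) else x.
have mulVx : {in unit, left_inverse 1 inv *%R}.
  by move=> x /asboolP ux; rewrite /inv; case: pselect => // h; case: (cid h).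
have unitPl x y : y * x = 1 -> unit x by move=> h; apply/asboolP; exists y.
have inv_out : {in [predC unit], inv =1 id}.
  by move=> x; rewrite inE => /asboolPn nu; rewrite /inv; case: pselect.
pose U : comUnitRingType :=
  HB.pack (GRing.ComNzRing.sort B) (GRing.ComNzRing_hasMulInverse.Build _ mulVx unitPl inv_out).
pose D : idomainType :=
  HB.pack (GRing.ComUnitRing.sort U) (GRing.ComUnitRing_isIntegral.Build U domB).
exists {fraction D}, (@FracField.tofrac D : {rmorphism D -> {fraction D}}).
split; first by move=> x y /eqP; rewrite tofrac_eq => /eqP.
by move=> z; have [a [b ?]] := fraction_numden z; exists a, b.
Qed.

Lemma malgU_scale (R : nzRingType) (T : choiceType) (c : R) (m : T) :
  << c *g m >> = c *: << m >> :> {malg R[T]}.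
Proof. by apply/malgP => m'; rewrite mcoeffZ !mcoeffU mulrnAr mulr1. Qed.

Section Straightening.
Variable k : fieldType.
Local Notation plucker_poly := {malg k[{cmonom chord}]}.
Local Notation I := (smallest (@is_ideal k) (@plucker_relations k)).
Local Notation X := (plucker_var k).
Implicit Types p q : plucker_poly.

Definition straightens p q :=
  I (p - q) /\ forall m, m \in msupp q -> nc_monomial id m.
Definition straightenable p := exists q, straightens p q.

Lemma ideal0 : I 0.
Proof. by have [] := smallest_plucker_is_ideal k. Qed.

Lemma idealD p q : I p -> I q -> I (p + q).
Proof. by have [_ + _] := smallest_plucker_is_ideal k; apply. Qed.

Lemma idealM p q : I q -> I (p * q).
Proof. by have [_ _] := smallest_plucker_is_ideal k; apply. Qed.

Lemma straightenable0 : straightenable 0.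
Proof.
exists 0; split; first by rewrite subrr; apply: ideal0.
by move=> m; rewrite msupp0 in_fset0.
Qed.

Lemma straightenableD p q : straightenable p -> straightenable q -> straightenable (p + q).
Proof.
move=> [p' [Ip nc]] [q' [Iq nc']]; exists (p' + q'); split.
  by rewrite opprD addrACA; apply: idealD.
by move=> m /(fsubsetP (msuppD_le _ _)); rewrite in_fsetU => /orP[/nc|/nc'].
Qed.

Lemma straightenableZ c p : straightenable p -> straightenable (c *: p).
Proof.
move=> [p' [Ip nc]]; exists (c *: p'); split.
  by rewrite -scalerBr -mul_malgC; apply: idealM.
by move=> m /(fsubsetP (msuppZ_le _ _)) /nc.
Qed.

Lemma straightenable_mod p q : I (p - q) -> straightenable q -> straightenable p.
Proof.
move=> pq [q' [Iq nc]]; exists q'; split=> //.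
by rewrite -(subrK q p) -addrA; apply: idealD.
Qed.

Definition len (a : chord) : nat := `|tgt a - src a|%N.

(** Twice the second elementary symmetric function of the lengths of the chords
    of [m]. Passing from a crossing pair to a pair of opposite sides of the
    quadrilateral on its ends does not increase the sum of the two lengths and
    lowers their product, hence lowers this number. *)
Definition cross_deg (m : {cmonom chord}) : nat :=
  (wdeg len m ^ 2 - wdeg (fun a => len a ^ 2) m)%N.

Lemma wdeg_sq_le m : (wdeg (fun a => len a ^ 2) m <= wdeg len m ^ 2)%N.
Proof.
rewrite -mulnn {1 2}/wdeg big_distrl /= !big_seq; apply: leq_sum => a am.
rewrite -mulnn mulnA leq_mul2l; apply/orP; right.
rewrite /wdeg (big_fsetD1 a) //=.
by apply: leq_trans (leq_addr _ _); rewrite leq_pmull // lt0n cmE_neq0.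
Qed.

Lemma cross_deg_lt m a b a' b' : (len a' + len b' <= len a + len b)%N ->
  (len a' * len b' < len a * len b)%N ->
  (cross_deg (mmul m (mmul (ucm a') (ucm b'))) < cross_deg (mmul m (mmul (ucm a) (ucm b))))%N.
Proof.
have degE (w : chord -> nat) c d :
    wdeg w (mmul m (mmul (ucm c) (ucm d))) = (wdeg w m + (w c + w d))%N.
  apply: etrans (wdegM w _ _) (congr1 (addn _) _).
  exact: etrans (wdegM w _ _) (congr2 addn (wdegU w _) (wdegU w _)).
have cross_degE c d : cross_deg (mmul m (mmul (ucm c) (ucm d))) =
    ((wdeg len m + (len c + len d)) ^ 2 -
     (wdeg (fun a => len a ^ 2) m + (len c ^ 2 + len d ^ 2)))%N.
  exact: (congr2 (fun x y => x ^ 2 - y)%N (degE len c d)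
    (degE (fun a => len a ^ 2)%N c d)).
move=> le lt; apply: leq_ltn_trans (eq_leq (cross_degE a' b')) _.
apply: leq_trans _ (eq_leq (esym (cross_degE a b))).
clear degE cross_degE.
have := wdeg_sq_le m; move: (wdeg _ m) (wdeg _ m) => L Q QL.
have expand x y : ((L + (x + y)) ^ 2 - (Q + (x ^ 2 + y ^ 2)) =
    (L ^ 2 - Q) + 2 * (L * (x + y)) + 2 * (x * y))%N.
  by rewrite -(subnKC QL) !sqrnD addKn -(subnKC QL); lia.
have leL : (L * (len a' + len b') <= L * (len a + len b))%N.
  by rewrite leq_mul2l le orbT.
by rewrite !expand; lia.
Qed.

Lemma cmonom_split2 (V : choiceType) (m : {cmonom V}) a b : a != b ->
  a \in finsupp m -> b \in finsupp m ->
  exists m0, m = mmul m0 (mmul (ucm a) (ucm b)).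
Proof.
move=> ab; rewrite -!cmE_neq0 => am bm.
exists (divcm m (mulcm (ucm a) (ucm b))); apply/eqP/cmP => v.
rewrite !cmM divcmE mulcmE !ucmE.
suff : ((a == v) + (b == v) <= m v)%N by lia.
case: eqP => [<-|_]; first by rewrite eq_sym (negbTE ab) addn0 lt0n.
by case: eqP => [<-|_] //; rewrite add0n lt0n.
Qed.

Lemma malgUM (m n : {cmonom chord}) : << mmul m n >> = << m >> * << n >> :> plucker_poly.
Proof. by rewrite malgM_def fgmulUU mulr1. Qed.

Lemma monomU2 (m : {cmonom chord}) a b :
  << mmul m (mmul (ucm a) (ucm b)) >> = << m >> * (X a * X b) :> plucker_poly.
Proof. exact: etrans (malgUM _ _) (congr1 _ (malgUM _ _)). Qed.

Lemma straightenable_monomial (m : {cmonom chord}) : straightenable << m >>.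
Proof.
have [n] := ubnP (cross_deg m); elim: n m => // n IH m lt.
case: (pselect (nc_monomial id m)) => [nc|].
  exists << m >>; split; first by rewrite subrr; apply: ideal0.
  by move=> m'; rewrite msuppU1 in_fset1 => /eqP ->.
move=> /existsNP [a /existsNP [b /not_implyP [am /not_implyP [bm /contrapT]]]] /=.
wlog [ab [ba bb]] : a b am bm / src a < src b /\ src b < tgt a /\ tgt a < tgt b.
  move=> H [] h; first by apply: (H a b) => //; left.
  by apply: (H b a) => //; left.
move=> _; have [m0 em] : exists m0, m = mmul m0 (mmul (ucm a) (ucm b)).
  by apply: cmonom_split2 => //; apply/eqP => eab; move: ab; rewrite eab; lia.
have distr3 (x y z t : plucker_poly) : x * y - (x * z + x * t) = x * (y - (z + t)).
  by rewrite mulrBr mulrDr.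
pose il := lt_trans (lt_trans ab ba) bb.
pose q1 := mmul m0 (mmul (ucm (mkchord ab)) (ucm (mkchord bb))).
pose q2 := mmul m0 (mmul (ucm (mkchord il)) (ucm (mkchord ba))).
apply: (@straightenable_mod _ (<< q1 >> + << q2 >>)).
  have -> : << m >> - (<< q1 >> + << q2 >>) = << m0 >> * plucker_relation k ab ba bb.
    rewrite em; apply: etrans (congr2 (fun x y => x - y) (monomU2 _ _ _)
      (congr2 +%R (monomU2 _ _ _) (monomU2 _ _ _))) _.
    apply: etrans (distr3 _ _ _ _) (congr1 _ _).
    rewrite /plucker_relation /= (_ : mkchord (lt_trans ab ba) = a); last exact: chord_inj.
    by rewrite (_ : mkchord (lt_trans ba bb) = b) //; apply: chord_inj.
  by apply: idealM => S [_]; apply; exists (src a), (src b), (tgt a), (tgt b), ab, ba, bb.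
(* With lengths [x], [y], [z] of the three intervals between the four ends,
   the pair [(x + y, y + z)] becomes [(x, z)] or [(x + y + z, y)]. *)
rewrite ltnS in lt.
apply: straightenableD; apply: IH; (apply: leq_trans _ lt); rewrite em; apply: cross_deg_lt.
all: rewrite /len /src /tgt /= -!/(src _) -!/(tgt _).
- lia.
- nia.
- lia.
- nia.
Qed.

Lemma straightening p : straightenable p.
Proof.
rewrite [p]monalgE; apply: big_ind.
- exact: straightenable0.
- exact: straightenableD.
move=> m _; rewrite malgU_scale.
exact/straightenableZ/straightenable_monomial.
Qed.

(** Since the bound is uniform from some [N0] on, two elements outside the ideal
    survive a common evaluation; this is what makes the ideal prime. *)
Lemma Kronecker_faithful p : ~ I p ->
  exists N0, forall N, (N0 <= N)%N -> Kronecker_eval N p != 0.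
Proof.
move=> nI; have [q [Iq nc]] := straightening p.
have q0 : q != 0.
  by apply/eqP => q0; apply: nI; rewrite q0 subr0 in Iq.
have [N0 H] := nc_independent (fun _ _ => id) nc q0.
exists N0 => N NN; have := H N NN.
suff -> : Kronecker_eval N p = Kronecker_eval N q by [].
by apply/eqP; rewrite -subr_eq0 -rmorphB; apply/eqP/Kronecker_eval_plucker_ideal.
Qed.

Lemma plucker_pi_eq0 p : \pi_{ideal_quot (@plucker_ideal k)} p = 0 <-> I p.
Proof.
have -> : (0 : Gr2 k) = \pi_{ideal_quot (@plucker_ideal k)} 0 by rewrite rmorph0.
split=> [/eqP|Ip]; first by rewrite -Quotient.idealrBE subr0 => /asboolP.
by apply/eqP; rewrite -Quotient.idealrBE subr0; apply/asboolP.
Qed.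

Lemma Gr2_domain : GRing.integral_domain_axiom (Gr2 k).
Proof.
move=> x y; rewrite -[x]reprK -[y]reprK.
move: (repr x) (repr y) => p q; rewrite -rmorphM /= => /plucker_pi_eq0 Ipq.
apply/orP; apply: contrapT => /not_orP [px qy].
have [N1 H1] : exists N0, forall N, (N0 <= N)%N -> Kronecker_eval N p != 0.
  by apply: Kronecker_faithful => Ip; apply/px/eqP/plucker_pi_eq0.
have [N2 H2] : exists N0, forall N, (N0 <= N)%N -> Kronecker_eval N q != 0.
  by apply: Kronecker_faithful => Iq; apply/qy/eqP/plucker_pi_eq0.
have := Kronecker_eval_plucker_ideal (N1 + N2)%N Ipq.
rewrite rmorphM /= => /eqP; rewrite mulf_eq0.
by rewrite (negbTE (H1 _ (leq_addr _ _))) (negbTE (H2 _ (leq_addl _ _))).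
Qed.

End Straightening.

(** * Pluecker coordinates as generators *)

Section Generation.
Variable k : fieldType.
Local Notation plucker_poly := {malg k[{cmonom chord}]}.

(** Every monomial in pairwise noncrossing chords is noncrossing, so a relation
    would contradict the independence of the noncrossing monomials. *)
Lemma plucker_alg_independent (K : fieldType) (iota : {rmorphism Gr2 k -> K})
    (V : choiceType) (e : V -> chord) :
  injective iota -> injective e -> (forall u v, ~ crossing (e u) (e v)) ->
  alg_independent (iota \o @Gr2_scalar k) (fun v => iota (plucker k (e v))).
Proof.
move=> iota_inj e_inj nc p p0; apply/eqP; apply: contrapT => /negP pn0.
pose P : plucker_poly := mmap (@malgC _ k) (monomial_eval (plucker_var k \o e)) p.
have IP : smallest (@is_ideal k) (@plucker_relations k) P.
  apply/plucker_pi_eq0; apply: iota_inj; rewrite rmorph0 -[RHS]p0.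
  rewrite /P (rmorph_mmap
    (\pi_{ideal_quot (@plucker_ideal k)} : {rmorphism plucker_poly -> Gr2 k})).
  by rewrite (rmorph_mmap iota).
have nc' m : m \in msupp p -> nc_monomial e m by move=> _ u v _ _; apply: nc.
have [N H] := nc_independent e_inj nc' pn0.
have /eqP := H N (leqnn N); apply; rewrite -(Kronecker_eval_plucker_ideal N IP).
rewrite /P (rmorph_mmap (Kronecker_eval N)).
congr (mmap _ (monomial_eval _) p); apply/funext => x /=.
  by rewrite /Kronecker_eval mmapC.
by rewrite Kronecker_eval_var.
Qed.

Lemma cmonom_split (V : choiceType) (m : {cmonom V}) a : a \in finsupp m ->
  exists m0, m = mmul m0 (ucm a).
Proof.
rewrite -cmE_neq0 => am; exists (divcm m (ucm a)); apply/eqP/cmP => v.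
rewrite cmM divcmE ucmE; case: eqP => [<-|_]; last by rewrite subn0 addn0.
by rewrite subnK // lt0n.
Qed.

Lemma gen_plucker_all : plucker_subalgebra k [set: chord] = [set: Gr2 k].
Proof.
apply/seteqP; split=> // x _ S [[Sc SD SM] Sp].
have {}Sp a : S (plucker k a) by apply: Sp; exists a.
have S0 : S 0.
  have -> : (0 : Gr2 k) = Gr2_scalar 0 by rewrite /Gr2_scalar malgC0E rmorph0.
  exact: Sc.
have Smon n : forall m : {cmonom chord}, (mdeg m < n)%N ->
    S (\pi_{ideal_quot (@plucker_ideal k)} << m >>).
  elim: n => // n IH m lt.
  case: (boolP (finsupp m == fset0)) => [m0|/fset0Pn [a am]].
    have -> : m = mone.
      apply: mdeg_eq0I; rewrite /mdeg (eqP m0); exact: big_seq_fset0.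
    exact: Sc.
  have [m0 em] := cmonom_split am.
  rewrite em malgUM rmorphM; apply: SM; last exact: Sp.
  apply: IH; rewrite em in lt.
  by have := mdegM m0 (ucm a); rewrite (mdegU a) => dE; rewrite dE in lt; lia.
rewrite -[x]reprK [repr x]monalgE rmorph_sum.
apply: big_ind => // m _; rewrite malgU_scale -mul_malgC rmorphM.
by apply: SM; [apply: Sc | apply: Smon (leqnn _)].
Qed.

End Generation.

(** * Maximal noncrossing sets of chords *)

Implicit Types (T : set chord) (a b c d e : chord).

Lemma exists_chord (i j : int) : i < j -> exists c, src c = i /\ tgt c = j.
Proof. by move=> ij; exists (mkchord ij). Qed.

Lemma int_max (P : int -> Prop) x B : P x -> (forall y, P y -> y <= B) ->
  exists2 m, P m & forall y, P y -> y <= m.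
Proof.
move=> Px ub.
have [n] := ubnP `|B - x|%N; elim: n x Px => // n IH x Px lt.
case: (pselect (exists2 y, P y & x < y)) => [[y Py xy]|nex].
  by apply: (IH y Py); have := ub y Py; lia.
by exists x => // y Py; rewrite leNgt; apply/negP => xy; apply: nex; exists y.
Qed.

Lemma int_min (P : int -> Prop) x B : P x -> (forall y, P y -> B <= y) ->
  exists2 m, P m & forall y, P y -> m <= y.
Proof.
move=> Px lb; have [||m Pm mP] := @int_max (fun y => P (- y)) (- x) (- B).
- by rewrite opprK.
- by move=> y /lb; lia.
exists (- m) => // y Py; have := mP (- y); rewrite opprK => /(_ Py); lia.
Qed.

(** Sides are allowed as elements and, crossing nothing, always belong to such a
    set; so a triangle of arcs and sides is simply a triangle in [T]. *)
Definition maximal_nc T :=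
  (forall a b, T a -> T b -> ~ crossing a b) /\
  (forall c, (forall d, T d -> ~ crossing c d) -> T c).

Definition covers d e :=
  src d <= src e /\ tgt e <= tgt d /\ tgt e - src e < tgt d - src d.

Lemma side_in_maximal T e : maximal_nc T -> is_side e -> T e.
Proof.
by rewrite /is_side /= => -[_ mx] se; apply: mx => d _; rewrite /crossing; have := chord_lt d; lia.
Qed.

Lemma triangulation_maximal t : triangulation t -> maximal_nc (t `|` is_side).
Proof.
move=> [[arcs nc] mx].
have side_nc a b : is_side a -> ~ crossing a b.
  by rewrite /is_side /crossing /= => sa; have := chord_lt b; lia.
split=> [a b|c nc_c].
  move=> [ta|sa] [tb|sb]; last 3 first.
  - by move/crossing_sym; apply: side_nc.
  - exact: side_nc.
  - exact: side_nc.
  exact: nc.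
case: (pselect (is_side c)) => [|nsc]; [by right | left].
have arc_c : is_arc c by move: nsc; rewrite /is_side /is_arc /=; have := chord_lt c; lia.
rewrite -(mx (t `|` [set c])); [by right | split | by move=> a ta; left].
  by move=> a [/arcs //|->].
move=> a b [ta|->] [tb|->].
- exact: nc.
- by move/crossing_sym; apply: nc_c; left.
- by apply: nc_c; left.
- by rewrite /crossing; lia.
Qed.

Section Maximal.
Variable T : set chord.
Hypothesis mx : maximal_nc T.
Let nc : forall a b, T a -> T b -> ~ crossing a b := mx.1.

Lemma not_in_maximal c : ~ T c -> exists2 d, T d & crossing c d.
Proof.
move=> nT; apply: contrapT => nex; apply: nT; apply: mx.2 => d Td cd.
by apply: nex; exists d.
Qed.

(** The apex is the last integer [q] before [tgt e] such that the chord from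
    [src e] to [q] is in [T]. A chord of [T] that crosses the one from [q] to
    [tgt e] would cross [e] or the chord from [src e] to [q], or would go from
    [src e] to an integer beyond [q]. *)
Lemma inner_apex e : T e -> ~ is_side e -> exists a b, [/\ T a, T b & triangle a b e].
Proof.
move=> Te; rewrite /is_side /= => nse; have lte := chord_lt e.
pose P q := exists a, [/\ T a, src a = src e, tgt a = q & q < tgt e].
have [c [sc tc]] : exists c, src c = src e /\ tgt c = src e + 1 by apply: exists_chord; lia.
have [|q Pq|q [a [Ta sa ta ltq]] qmax] := @int_max P (src e + 1) (tgt e).
- exists c; split=> //; last by lia.
  by apply: side_in_maximal => //; rewrite /is_side /= sc.
- by case: Pq => a []; lia.
have [b [sb tb]] := exists_chord ltq.
exists a, b; split=> //; last by split; lia.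
apply: contrapT => /not_in_maximal [d Td]; have := nc Td Te; have := nc Td Ta.
have ltd := chord_lt d; have lta := chord_lt a.
have max_d : src d = src e -> tgt d < tgt e -> tgt d <= q.
  by move=> sd td; apply: qmax; exists d.
by rewrite /crossing sa ta sb tb; lia.
Qed.

(** In the triangle under a shortest chord covering [e], one of the two shorter
    sides must be [e]: otherwise it would cross [e] or cover it. *)
Lemma outer_apex e d : T e -> T d -> covers d e ->
  exists a b, [/\ T a, T b & triangle e a b \/ triangle a e b].
Proof.
move=> Te; move: d.
suff H n d : (`|tgt d - src d| < n)%N -> T d -> covers d e ->
    exists a b, [/\ T a, T b & triangle e a b \/ triangle a e b].
  by move=> d; apply: H (leqnn _).
elim: n d => // n IH d lt Td; rewrite /covers => cov.
have lte := chord_lt e; have ltd := chord_lt d.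
have [|a [b [Ta Tb [sad tasb tbd]]]] := inner_apex Td; first by rewrite /is_side /=; lia.
have lta := chord_lt a; have ltb := chord_lt b.
have := nc Te Ta; have := nc Te Tb; rewrite /crossing => ncb nca.
case: (pselect (covers b e)) => [|nb]; first by apply: IH => //; lia.
case: (pselect (covers a e)) => [|na]; first by apply: IH => //; lia.
move: na nb; rewrite /covers => na nb.
case: (ltP (src e) (tgt a)) => h.
  have ea : e = a by apply: chord_inj; lia.
  by subst a; exists b, d; split=> //; left.
have eb : e = b by apply: chord_inj; lia.
by subst b; exists a, d; split=> //; right.
Qed.

(** Otherwise let [q] be the last integer joined to [tgt e] from the right. The
    chord from [src e] to [q] covers [e], so it is not in [T]; but a chord of
    [T] that crosses it would cross [e] or the chord from [tgt e] to [q], cover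
    [e], or join [tgt e] to an integer beyond [q]. *)
Lemma uncovered_right e B : T e -> (forall d, T d -> ~ covers d e) ->
  exists d, [/\ T d, src d = tgt e & B < tgt d].
Proof.
move=> Te ncov; apply: contrapT => nex; have lte := chord_lt e.
pose P q := exists a, [/\ T a, src a = tgt e & tgt a = q].
have [c [sc tc]] : exists c, src c = tgt e /\ tgt c = tgt e + 1 by apply: exists_chord; lia.
have [|q [a [Ta sa ta]]|q [a [Ta sa ta]] qmax] := @int_max P (tgt e + 1) B.
- by exists c; split=> //; apply: side_in_maximal => //; rewrite /is_side /= sc.
- by rewrite leNgt; apply/negP => lt; apply: nex; exists a; rewrite ta.
have lta := chord_lt a.
have [|b [sb tb]] := @exists_chord (src e) q; first by lia.
case: (pselect (T b)) => [/ncov|/not_in_maximal [d Td]]; first by rewrite /covers; lia.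
have := nc Td Te; have := nc Td Ta; have := ncov d Td; have ltd := chord_lt d.
have max_d : src d = tgt e -> tgt d <= q by move=> sd; apply: qmax; exists d.
by rewrite /crossing /covers; lia.
Qed.

Lemma uncovered_left e B : T e -> (forall d, T d -> ~ covers d e) ->
  exists d, [/\ T d, tgt d = src e & src d < B].
Proof.
move=> Te ncov; apply: contrapT => nex; have lte := chord_lt e.
pose P q := exists a, [/\ T a, tgt a = src e & src a = q].
have [c [sc tc]] : exists c, src c = src e - 1 /\ tgt c = src e by apply: exists_chord; lia.
have [|q [a [Ta sa ta]]|q [a [Ta sa ta]] qmin] := @int_min P (src e - 1) B.
- by exists c; split=> //; apply: side_in_maximal => //; rewrite /is_side /= sc; lia.
- by rewrite leNgt; apply/negP => lt; apply: nex; exists a; rewrite ta.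
have lta := chord_lt a.
have [|b [sb tb]] := @exists_chord q (tgt e); first by lia.
case: (pselect (T b)) => [/ncov|/not_in_maximal [d Td]]; first by rewrite /covers; lia.
have := nc Td Te; have := nc Td Ta; have := ncov d Td; have ltd := chord_lt d.
have min_d : tgt d = src e -> q <= src d by move=> sd; apply: qmin; exists d.
by rewrite /crossing /covers; lia.
Qed.

End Maximal.

(** * Flips *)

Local Notation ends c i j := (src c = i /\ tgt c = j).

(** The diagonals [v], [v'] and the edges of a quadrilateral in cyclic order,
    numbered in such a way that the exchange quiver has arrows from [e1] and
    [e3] to [v], and from [v] to [e2] and [e4]. *)
Definition flip_quad v v' e1 e2 e3 e4 := exists p q r s : int,
  [/\ p < q, q < r, r < s &
    [/\ ends v p r, ends v' q s & [/\ ends e1 p q, ends e2 q r, ends e3 r s & ends e4 p s]] \/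
    [/\ ends v q s, ends v' p r & [/\ ends e1 q r, ends e2 r s, ends e3 p s & ends e4 p q]]].

Definition flip T v v' : set chord := [set c | (T c /\ c <> v) \/ c = v'].

(** The arrows of the exchange quiver inside the triangle on [a], [b], [c] run
    from [a] to [b] to [c] to [a]. *)
Definition oriented a b c := [\/ triangle a c b, triangle c b a | triangle b a c].

(** Unlike in the exchange quiver, arrows between frozen chords are kept, so
    that flips act on this relation uniformly. *)
Definition arrow T a b := exists2 c, T c & oriented a b c.

Definition edges_in T e1 e2 e3 e4 := [/\ T e1, T e2, T e3 & T e4].

Lemma orientedE a b c : oriented a b c <->
  (src a = src b /\ tgt a = src c /\ tgt c = tgt b) \/
  (src c = src a /\ tgt c = src b /\ tgt b = tgt a) \/
  (src b = src c /\ tgt b = src a /\ tgt a = tgt c).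
Proof.
split=> [[] [? ? ?]|[|[]] [? [? ?]]].
- by left.
- by right; left.
- by right; right.
- by apply: Or31.
- by apply: Or32.
- by apply: Or33.
Qed.

Lemma oriented_rot a b c : oriented a b c -> oriented b c a.
Proof. by case=> h; [apply: Or32 | apply: Or33 | apply: Or31]. Qed.

Lemma oriented_third a b c c' : oriented a b c -> oriented a b c' -> c = c'.
Proof.
have := chord_lt a; have := chord_lt b; have := chord_lt c; have := chord_lt c'.
by move=> ? ? ? ? [] [? ? ?] [] [? ? ?]; apply: chord_inj; lia.
Qed.

Lemma oriented_antisym a b c c' : oriented a b c -> ~ oriented b a c'.
Proof.
have := chord_lt a; have := chord_lt b; have := chord_lt c; have := chord_lt c'.
by move=> ? ? ? ? [] [? ? ?] [] [? ? ?]; lia.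
Qed.

Lemma oriented_neq a b c : oriented a b c -> a <> b.
Proof. by move=> h e; apply: (oriented_antisym h); rewrite e in h *; exact: h. Qed.

Lemma flip_quad_oriented v v' e1 e2 e3 e4 : flip_quad v v' e1 e2 e3 e4 ->
  [/\ oriented e1 v e2, oriented e3 v e4, oriented e2 v' e3 & oriented e4 v' e1].
Proof.
move=> [p [q [r [s [pq qr rs [] [? ? [? ? ? ?]]]]]]];
  split; apply/orientedE; lia.
Qed.

Lemma flip_quad_crossing v v' e1 e2 e3 e4 : flip_quad v v' e1 e2 e3 e4 -> crossing v v'.
Proof.
by move=> [p [q [r [s [pq qr rs [] [? ? [? ? ? ?]]]]]]]; rewrite /crossing; lia.
Qed.

(** The edge under which the whole quadrilateral lies keeps both diagonals
    covered, before and after the flip. *)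
Lemma flip_quad_hull v v' e1 e2 e3 e4 : flip_quad v v' e1 e2 e3 e4 ->
  exists2 h, h = e3 \/ h = e4 & covers h v /\ covers h v'.
Proof.
move=> [p [q [r [s [pq qr rs [] [? ? [? ? ? ?]]]]]]].
  by exists e4; [right | rewrite /covers; lia].
by exists e3; [left | rewrite /covers; lia].
Qed.

Lemma flip_quad_sym v v' e1 e2 e3 e4 : flip_quad v v' e1 e2 e3 e4 ->
  flip_quad v' v e2 e3 e4 e1 \/ flip_quad v' v e4 e1 e2 e3.
Proof.
move=> [p [q [r [s [pq qr rs [] [? ? [? ? ? ?]]]]]]]; [left|right];
  exists p, q, r, s; split=> //; [right|left]; split=> //; split=> //.
Qed.

(** In a noncrossing set a chord belongs to at most one triangle on each side,
    and the quadrilateral already provides both. *)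
Lemma flip_quad_uniq T v v' e1 e2 e3 e4 a b : (forall c d, T c -> T d -> ~ crossing c d) ->
  T v -> edges_in T e1 e2 e3 e4 -> flip_quad v v' e1 e2 e3 e4 ->
  T a -> T b -> oriented a v b -> (a = e1 /\ b = e2) \/ (a = e3 /\ b = e4).
Proof.
move=> nc Tv [T1 T2 T3 T4] quad Ta Tb /orientedE cyc_avb.
have [lta ltb] := (chord_lt a, chord_lt b).
have [b1 a2 b3 a4] : [/\ ~ crossing b e1, ~ crossing a e2, ~ crossing b e3 & ~ crossing a e4].
  by split; apply: nc.
have eqc c d : ends c (src d) (tgt d) -> c = d by case; apply: chord_inj.
move: quad => [p [q [r [s [pq qr rs [] [? ? [? ? ? ?]]]]]]];
  case: cyc_avb => [|[]] [? [? ?]].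
(* The third corner of the triangle on [a], [v], [b] lies under [v], to its
   left, or to its right; this for each of the two diagonals. *)
- by left; split; apply: eqc; move: b1 a2; rewrite /crossing; lia.
- by exfalso; move: a4; rewrite /crossing; lia.
- by right; split; apply: eqc; move: b3 a4; rewrite /crossing; lia.
- by left; split; apply: eqc; move: b1 a2; rewrite /crossing; lia.
- by right; split; apply: eqc; move: b3 a4; rewrite /crossing; lia.
- by exfalso; move: b3; rewrite /crossing; lia.
Qed.

(** A chord that enters a quadrilateral without crossing its edges joins two
    opposite corners. *)
Lemma flip_quad_diagonal v v' e1 e2 e3 e4 c : flip_quad v v' e1 e2 e3 e4 ->
  ~ crossing c e1 -> ~ crossing c e2 -> ~ crossing c e3 -> ~ crossing c e4 ->
  crossing c v -> c = v'.
Proof.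
move=> [p [q [r [s [pq qr rs [] [[? ?] [? ?] [[? ?] [? ?] [? ?] [? ?]]]]]]]] n1 n2 n3 n4;
  have ltc := chord_lt c; rewrite {1}/crossing => -[[? [? ?]]|[? [? ?]]].
- by exfalso; move: n4; rewrite /crossing; lia.
- apply: chord_inj.
    by move: n1 n2; rewrite /crossing; lia.
  by move: n3 n4; rewrite /crossing; lia.
- apply: chord_inj.
    by move: n3 n4; rewrite /crossing; lia.
  by move: n1 n2; rewrite /crossing; lia.
- by exfalso; move: n3; rewrite /crossing; lia.
Qed.

Section FlipMaximal.
Variables (T : set chord) (v v' e1 e2 e3 e4 : chord).
Hypothesis mx : maximal_nc T.
Hypothesis Tv : T v.
Hypothesis quad : flip_quad v v' e1 e2 e3 e4.
Hypothesis Te : edges_in T e1 e2 e3 e4.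

Lemma flip_notin : ~ T v'.
Proof. by move=> Tv'; apply: mx.1 Tv Tv' (flip_quad_crossing quad). Qed.

Lemma edges_in_flip : edges_in (flip T v v') e1 e2 e3 e4.
Proof.
have [/oriented_neq n1 /oriented_neq n3 c2 c4] := flip_quad_oriented quad.
have [/oriented_rot/oriented_neq n2 /oriented_rot/oriented_neq n4 _ _] := flip_quad_oriented quad.
have [T1 T2 T3 T4] := Te.
by split; left; split=> // h; subst.
Qed.

Lemma flip_maximal : maximal_nc (flip T v v').
Proof.
have [T1 T2 T3 T4] := Te.
have nc_v' c : T c -> crossing c v' -> c = v.
  move=> Tc cv'.
  by case: (flip_quad_sym quad) => /flip_quad_diagonal; apply=> //; apply: mx.1.
split.
  move=> a b [[Ta av]|->] [[Tb bv]|->].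
  - exact: mx.1.
  - by move=> h; apply/av/nc_v'.
  - by move/crossing_sym => h; apply/bv/nc_v'.
  - by rewrite /crossing; lia.
move=> c nc; case: (pselect (crossing c v)) => [cv|ncv].
  have [F1 F2 F3 F4] := edges_in_flip.
  by right; apply: (flip_quad_diagonal quad) => //; apply: nc.
left; split.
  apply: mx.2 => d Td; case: (pselect (d = v)) => [->//|dv].
  by apply: nc; left.
move=> cv; apply: (nc v'); first by right.
by rewrite cv; apply: flip_quad_crossing quad.
Qed.

Lemma arrow_to_v a : T a -> arrow T a v <-> a = e1 \/ a = e3.
Proof.
have [c1 c3 _ _] := flip_quad_oriented quad; have [T1 T2 T3 T4] := Te.
move=> Ta; split=> [[b Tb h]|[]->]; [|by exists e2|by exists e4].
by case: (flip_quad_uniq mx.1 Tv Te quad Ta Tb h) => -[-> _]; [left|right].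
Qed.

Lemma arrow_of_v b : T b -> arrow T v b <-> b = e2 \/ b = e4.
Proof.
have [c1 c3 _ _] := flip_quad_oriented quad; have [T1 T2 T3 T4] := Te.
move=> Tb; split=> [[a Ta /oriented_rot/oriented_rot h]|[]->]; last 2 first.
- by exists e1 => //; apply: oriented_rot.
- by exists e3 => //; apply: oriented_rot.
by case: (flip_quad_uniq mx.1 Tv Te quad Ta Tb h) => -[_ ->]; [left|right].
Qed.

(** The arrows due to triangles that do not have [v] as a side; flipping [v]
    leaves them in place. *)
Definition arrow_off a b := exists2 c, T c /\ c <> v & oriented a b c.

Lemma arrow_on a b : T a -> T b ->
  arrow T a b <-> [\/ arrow_off a b, a = e2 /\ b = e1 | a = e4 /\ b = e3].
Proof.
have [c1 c3 _ _] := flip_quad_oriented quad.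
move=> Ta Tb; split.
  move=> [c Tc h]; case: (pselect (c = v)) => [cv|]; last by move=> nv; apply: Or31; exists c.
  rewrite cv in h; have := flip_quad_uniq mx.1 Tv Te quad Tb Ta (oriented_rot h).
  by case=> -[-> ->]; [apply: Or32 | apply: Or33].
case=> [[c [Tc _] h]|[-> ->]|[-> ->]]; first by exists c.
- by exists v => //; apply/oriented_rot/oriented_rot.
- by exists v => //; apply/oriented_rot/oriented_rot.
Qed.

End FlipMaximal.

Lemma flip_quad_neq v v' e1 e2 e3 e4 : flip_quad v v' e1 e2 e3 e4 -> e1 <> e3 /\ e2 <> e4.
Proof.
by move=> [p [q [r [s [pq qr rs [] [? ? [? ? ? ?]]]]]]]; split=> e; subst; lia.
Qed.

Section FlipArrows.
Variables (T : set chord) (v v' e1 e2 e3 e4 : chord).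
Hypothesis mx : maximal_nc T.
Hypothesis Tv : T v.
Hypothesis quad : flip_quad v v' e1 e2 e3 e4.
Hypothesis Te : edges_in T e1 e2 e3 e4.
Local Notation T' := (flip T v v').

Lemma flip_arrow_off a b : arrow_off T' v' a b <-> arrow_off T v a b.
Proof.
have nv' := flip_notin mx Tv quad.
split=> -[c [Tc cv] cyc_c]; exists c => //.
  by case: Tc => [[]|].
by split; [left | move=> ecv'; apply: nv'; rewrite -ecv'].
Qed.

Lemma flip_arrow_on a b : T' a -> T' b ->
  arrow T' a b <-> [\/ arrow_off T v a b, a = e3 /\ b = e2 | a = e1 /\ b = e4].
Proof.
have mx' := flip_maximal mx quad Te.
have Tv' : T' v' by right.
have [F1 F2 F3 F4] := edges_in_flip quad Te.
move=> Ta Tb; case: (flip_quad_sym quad) => quad'.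
  have Te' : edges_in T' e2 e3 e4 e1 by [].
  apply: iff_trans (arrow_on mx' Tv' quad' Te' Ta Tb) _.
  by split=> -[/flip_arrow_off h|h|h]; [apply: Or31|apply: Or32|apply: Or33|
    apply: Or31|apply: Or32|apply: Or33].
have Te' : edges_in T' e4 e1 e2 e3 by [].
apply: iff_trans (arrow_on mx' Tv' quad' Te' Ta Tb) _.
by split=> -[/flip_arrow_off h|h|h]; [apply: Or31|apply: Or33|apply: Or32|
  apply: Or31|apply: Or33|apply: Or32].
Qed.

Lemma flip_to_v' a : T' a -> arrow T' a v' <-> a = e2 \/ a = e4.
Proof.
have mx' := flip_maximal mx quad Te.
have Tv' : T' v' by right.
have [F1 F2 F3 F4] := edges_in_flip quad Te.
move=> Ta; case: (flip_quad_sym quad) => quad'.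
  by apply: arrow_to_v quad' _ _ _.
apply: iff_trans (arrow_to_v mx' Tv' quad' _ Ta) _ => //.
by split=> -[]; [right|left|right|left].
Qed.

Lemma flip_of_v' a : T' a -> arrow T' v' a <-> a = e1 \/ a = e3.
Proof.
have mx' := flip_maximal mx quad Te.
have Tv' : T' v' by right.
have [F1 F2 F3 F4] := edges_in_flip quad Te.
move=> Ta; case: (flip_quad_sym quad) => quad'; last first.
  by apply: arrow_of_v quad' _ _ _.
apply: iff_trans (arrow_of_v mx' Tv' quad' _ Ta) _ => //.
by split=> -[]; [right|left|right|left].
Qed.

(** The triangles at [v] account for the arrows from [e2] to [e1] and from [e4]
    to [e3]. The paths through [v] add arrows from [e1] and [e3] to [e2] and
    [e4]; two of these four cancel the former arrows, and the other two, from
    [e1] to [e4] and from [e3] to [e2], are those due to the triangles at [v']. *)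
Lemma flip_arrow_mutation a b : T a -> T b -> a <> v -> b <> v ->
  nat_of_bool `[< arrow T' a b >] =
  (`[< arrow T a b >] + `[< arrow T a v >] * `[< arrow T v b >] -
   (`[< arrow T b a >] + `[< arrow T b v >] * `[< arrow T v a >]))%N.
Proof.
move=> Ta Tb av bv.
have [c1 c3 c2 c4] := flip_quad_oriented quad.
have T'a : T' a by left.
have T'b : T' b by left.
have E1 c : T c -> `[< arrow T c v >] = (c == e1) || (c == e3).
  move=> Tc; apply/asboolP/orP => [/(arrow_to_v mx Tv quad Te Tc) []->|h].
  - by left.
  - by right.
  by apply/(arrow_to_v mx Tv quad Te Tc); case: h => /eqP; [left|right].
have E2 c : T c -> `[< arrow T v c >] = (c == e2) || (c == e4).
  move=> Tc; apply/asboolP/orP => [/(arrow_of_v mx Tv quad Te Tc) []->|h].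
  - by left.
  - by right.
  by apply/(arrow_of_v mx Tv quad Te Tc); case: h => /eqP; [left|right].
have E3 c d : T c -> T d -> `[< arrow T c d >] = [|| `[< arrow_off T v c d >],
    (c == e2) && (d == e1) | (c == e4) && (d == e3)].
  move=> Tc Td; apply/asboolP/or3P => [/(arrow_on mx Tv quad Te Tc Td) []|h].
  - by move=> /asboolP; apply: Or31.
  - by move=> [-> ->]; rewrite !eqxx; apply: Or32.
  - by move=> [-> ->]; rewrite !eqxx; apply: Or33.
  apply/(arrow_on mx Tv quad Te Tc Td); case: h => [/asboolP|/andP[/eqP + /eqP]|/andP[/eqP + /eqP]].
  - exact: Or31.
  - by move=> *; apply: Or32.
  - by move=> *; apply: Or33.
have -> : `[< arrow T' a b >] = [|| `[< arrow_off T v a b >],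
    (a == e3) && (b == e2) | (a == e1) && (b == e4)].
  apply/asboolP/or3P => [/(flip_arrow_on T'a T'b) []|h].
  - by move=> /asboolP; apply: Or31.
  - by move=> [-> ->]; rewrite !eqxx; apply: Or32.
  - by move=> [-> ->]; rewrite !eqxx; apply: Or33.
  apply/(flip_arrow_on T'a T'b); case: h => [/asboolP|/andP[/eqP + /eqP]|/andP[/eqP + /eqP]].
  - exact: Or31.
  - by move=> *; apply: Or32.
  - by move=> *; apply: Or33.
rewrite !E1 // !E2 // !E3 //.
have off_v c d : arrow_off T v c d -> ~ oriented c d v /\ ~ oriented c d v'.
  move=> [g [Tg gv] cyc_g]; split=> /(oriented_third cyc_g) eg //.
  by apply: (flip_notin mx Tv quad); rewrite -eg.
have off_anti c d g : arrow_off T v c d -> ~ oriented d c g.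
  by move=> [h _ cyc_h]; apply: oriented_antisym cyc_h.
have offD c d : arrow_off T v c d -> ~~ [|| (c == e2) && (d == e1), (c == e4) && (d == e3),
    (c == e3) && (d == e2) | (c == e1) && (d == e4)].
  move=> off; have [nv nv'] := off_v _ _ off.
  apply/negP => /or4P [] /andP[/eqP ec /eqP ed]; rewrite ec ed in nv nv'.
  - by apply: nv; do 2 apply: oriented_rot.
  - by apply: nv; do 2 apply: oriented_rot.
  - by apply: nv'; do 2 apply: oriented_rot.
  - by apply: nv'; do 2 apply: oriented_rot.
have offDr c d : arrow_off T v c d -> ~~ [|| (d == e2) && (c == e1), (d == e4) && (c == e3),
    (d == e3) && (c == e2) | (d == e1) && (c == e4)].
  move=> off; have anti g := off_anti _ _ g off.
  apply/negP => /or4P [] /andP[/eqP ed /eqP ec]; rewrite ec ed in anti.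
  - by apply: (anti v); do 2 apply: oriented_rot.
  - by apply: (anti v); do 2 apply: oriented_rot.
  - by apply: (anti v'); do 2 apply: oriented_rot.
  - by apply: (anti v'); do 2 apply: oriented_rot.
have distinct c : [&& ~~ ((c == e1) && (c == e2)), ~~ ((c == e2) && (c == e3)),
    ~~ ((c == e3) && (c == e4)), ~~ ((c == e4) && (c == e1)),
    ~~ ((c == e1) && (c == e3)) & ~~ ((c == e2) && (c == e4))].
  have n12 := oriented_neq (oriented_rot (oriented_rot c1)).
  have n34 := oriented_neq (oriented_rot (oriented_rot c3)).
  have n23 := oriented_neq (oriented_rot (oriented_rot c2)).
  have n41 := oriented_neq (oriented_rot (oriented_rot c4)).
  have [n13 n24] := flip_quad_neq quad.
  by do 6?[apply/andP; split]; apply/negP => /andP[/eqP -> /eqP]; try by apply/nesym; try exact.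
have xy : ~~ (`[< arrow_off T v a b >] && `[< arrow_off T v b a >]).
  by apply/negP => /andP[/asboolP offab /asboolP [g _ cg]]; apply: off_anti offab cg.
have := distinct a; have := distinct b; move: xy.
have : `[< arrow_off T v a b >] || `[< arrow_off T v b a >] ->
  ~~ [|| (a == e2) && (b == e1), (a == e4) && (b == e3),
    (a == e3) && (b == e2) | (a == e1) && (b == e4)] /\
  ~~ [|| (b == e2) && (a == e1), (b == e4) && (a == e3),
    (b == e3) && (a == e2) | (b == e1) && (a == e4)].
  by case/orP => /asboolP off; [have := offD _ _ off; have := offDr _ _ off |
    have := offDr _ _ off; have := offD _ _ off].
(* What is left is a tautology in the positions of [a] and [b] among the
   edges. *)
case: (a == e1); case: (a == e2) => //; case: (a == e3) => //; case: (a == e4) => //;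
case: (b == e1); case: (b == e2) => //; case: (b == e3) => //; case: (b == e4) => //;
by case: `[< arrow_off T v a b >]; case: `[< arrow_off T v b a >] => //= /(_ isT) [].
Qed.
End FlipArrows.

(** * Fountains *)

Lemma finite_int_interval (lo hi : int) : finite_set [set x : int | lo <= x /\ x <= hi].
Proof.
apply: (@sub_finite_set _ _ ((fun n : nat => lo + n%:Z) @` `I_(`|hi - lo|.+1))).
  by move=> x /= [lx xh]; exists `|x - lo|%N; [rewrite /=; lia | lia].
exact/finite_image/finite_II.
Qed.

Lemma bounded_finite (A : set chord) (lo hi : int) :
  (forall a, A a -> lo <= src a /\ tgt a <= hi) -> finite_set A.
Proof.
move=> bd; apply: (@sub_finite_set _ _ (val @^-1`
    ([set x : int | lo <= x /\ x <= hi] `*` [set x : int | lo <= x /\ x <= hi]))).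
  move=> a /bd [la ah] /=; have lta := chord_lt a.
  by rewrite -/(src a) -/(tgt a); lia.
apply: finite_preimage; first by move=> a b _ _ /val_inj.
by apply: finite_setX; exact: finite_int_interval.
Qed.

Lemma finite_seq (A : set chord) : finite_set A -> exists s : seq chord, forall a, A a -> a \in s.
Proof. by move=> /finite_seqP [s ->]; exists s. Qed.

Lemma finite_bounded (A : set chord) : finite_set A ->
  exists B : int, forall a, A a -> - B <= src a /\ tgt a <= B.
Proof.
move=> /finite_seq [s As].
have [|N H] := @eventually_all _ s (fun N a => (`|src a| <= N)%N /\ (`|tgt a| <= N)%N).
  by move=> a _; exists (`|src a| + `|tgt a|)%N => N; lia.
by exists N%:Z => a /As /(H N (leqnn N)); lia.
Qed.

Lemma right_fountainP t n : right_fountain t n <->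
  forall B, exists a, [/\ t a, src a = n & B < tgt a].
Proof.
split=> [inf B|unb fin].
  apply: contrapT => nex; apply: inf; apply: (@bounded_finite _ n B) => a [ta sa].
  rewrite sa; split=> //; rewrite leNgt; apply/negP => lt.
  by apply: nex; exists a.
have [B bd] := finite_bounded fin; have [a [ta sa]] := unb B.
by have [_] := bd a (conj ta sa); lia.
Qed.

Lemma left_fountainP t n : left_fountain t n <->
  forall B, exists a, [/\ t a, tgt a = n & src a < B].
Proof.
split=> [inf B|unb fin].
  apply: contrapT => nex; apply: inf; apply: (@bounded_finite _ B n) => a [ta sa].
  rewrite sa; split=> //; rewrite leNgt; apply/negP => lt.
  by apply: nex; exists a.
have [B bd] := finite_bounded fin; have [a [ta sa]] := unb (- B).
by have [] := bd a (conj ta sa); lia.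
Qed.

Section Fountains.
Variable t : set chord.
Hypothesis tP : triangulation t.

Definition fountain_vertex m := left_fountain t m \/ right_fountain t m.

Definition region : set chord :=
  [set c | forall m, fountain_vertex m -> ~ (src c < m /\ m < tgt c)].

(** For a split fountain this is the frozen arc from [l] to [r]; for a
    triangulation of another kind it is empty. *)
Definition bridge : set chord :=
  [set c | left_fountain t (src c) /\ right_fountain t (tgt c)].

Definition chords := t `|` is_side.

(** An invariant of flips that allows all further flips: covered chords are
    those with a triangle on their outer side. *)
Definition flippable T := [/\ maximal_nc T,
  forall e, T e -> ~ bridge e -> exists2 d, T d & covers d e,
  T `<=` region & bridge `<=` T].

(** An arc passing over a fountain vertex would cross a sufficiently long arc
    ending there, and only such arcs can cross a bridge. *)
Lemma flippable_chords : flippable chords.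
Proof.
have mx : maximal_nc chords by apply: triangulation_maximal.
have reg : chords `<=` region.
  move=> a Ta m [/left_fountainP|/right_fountainP].
    move=> /(_ (src a)) [b [tb eb lb]] ma; have Tb : chords b by left.
    by apply: (mx.1 b a Tb Ta); left; lia.
  move=> /(_ (tgt a)) [b [tb eb lb]] ma; have Tb : chords b by left.
  by apply: (mx.1 b a Tb Ta); right; lia.
split=> //.
  move=> e Te nb; apply: contrapT => nex; apply: nb.
  have ncov d : chords d -> ~ covers d e by move=> Td cov; apply: nex; exists d.
  split.
    apply/left_fountainP => B.
    have [d [[td|sd] ed ld]] := uncovered_left mx (Num.min B (src e - 1)) Te ncov.
      by exists d; split=> //; lia.
    by move: sd; rewrite /is_side /=; lia.
  apply/right_fountainP => B.
  have [d [[td|sd] ed ld]] := uncovered_right mx (Num.max B (tgt e + 1)) Te ncov.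
    by exists d; split=> //; lia.
  by move: sd; rewrite /is_side /=; lia.
move=> c [lf rf]; apply: mx.2 => d Td [] h.
  by apply: (reg d Td (tgt c)); [right | lia].
by apply: (reg d Td (src c)); [left | lia].
Qed.

Lemma flippable_flip T v v' e1 e2 e3 e4 : flippable T -> T v -> ~ bridge v ->
  flip_quad v v' e1 e2 e3 e4 -> edges_in T e1 e2 e3 e4 -> flippable (flip T v v').
Proof.
move=> [mx cov reg br] Tv nbv quad Te.
have [h hh [hv hv']] := flip_quad_hull quad.
have [F1 F2 F3 F4] := edges_in_flip quad Te.
have Th : T h by case: Te => ? ? ? ?; case: hh => ->.
have T'h : flip T v v' h by case: hh => ->.
split; first exact: flip_maximal quad Te.
- move=> e [[Te' ev]|->] nb; last by exists h.
  have [d Td cde] := cov e Te' nb.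
  case: (pselect (d = v)) => [dv|dv]; last by exists d => //; left.
  by exists h => //; move: hv cde; rewrite dv /covers; lia.
- move=> c [[Tc _]|->]; first exact: reg.
  by move=> m fm lt; apply: (reg h Th m fm); move: hv'; rewrite /covers; lia.
- move=> c bc; left; split; first exact: br.
  by move=> cv; apply: nbv; rewrite -cv.
Qed.

Lemma exists_flip_quad T v : flippable T -> T v -> ~ is_side v -> ~ bridge v ->
  exists v' e1 e2 e3 e4, flip_quad v v' e1 e2 e3 e4 /\ edges_in T e1 e2 e3 e4.
Proof.
move=> [mx cov _ _] Tv nsv nbv.
have [a [b [Ta Tb [sa ta tb]]]] := inner_apex mx Tv nsv.
have [d Td cdv] := cov v Tv nbv.
have [x [y [Tx Ty xy]]] := outer_apex mx Tv Td cdv.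
have lta := chord_lt a; have ltb := chord_lt b; have ltx := chord_lt x; have lty := chord_lt y.
case: xy => [[sy ty tx]|[sx tx ty]].
  have [|v' [sv' tv']] := @exists_chord (tgt a) (tgt x); first by lia.
  exists v', a, b, x, y; split=> //.
  exists (src v), (tgt a), (tgt v), (tgt x); split; [lia|lia|lia|].
  by left; repeat split; lia.
have [|v' [sv' tv']] := @exists_chord (src x) (tgt a); first by lia.
exists v', a, b, y, x; split=> //.
exists (src x), (src v), (tgt a), (tgt v); split; [lia|lia|lia|].
by right; repeat split; lia.
Qed.

(** A chord that crosses [c] has an end strictly between the ends of [c], where
    there is no fountain; so only finitely many arcs end at each of these
    finitely many integers. *)
Lemma finite_crossing c : region c -> exists s : seq chord,
  forall d, chords d -> crossing c d -> d \in s.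
Proof.
move=> rc; pose A m := [set a | t a /\ (src a = m \/ tgt a = m)].
have fin : finite_set (\bigcup_(m in [set m | src c + 1 <= m /\ m <= tgt c - 1]) A m).
  apply: bigcup_finite => [|m /= lt]; first exact: finite_int_interval.
  have nf : ~ fountain_vertex m by move/rc; apply; lia.
  have -> : A m = [set a | t a /\ src a = m] `|` [set a | t a /\ tgt a = m].
    by apply/seteqP; split=> a /=; rewrite /A /=; tauto.
  rewrite finite_setU; split; apply: contrapT => inf; apply: nf => //.
    by right.
  by left.
have [s sP] := finite_seq fin; exists s => d [td|sd] cd; last first.
  by move: sd cd; rewrite /is_side /crossing /=; have := chord_lt c; lia.
apply: sP; case: cd => h.
  by exists (src d); rewrite /= ?/A /=; [lia | tauto].
by exists (tgt d); rewrite /= ?/A /=; [lia | tauto].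
Qed.

(** Let [e] be the longest chord of [T] from [src c] to an integer before [tgt
    c]. In the triangle on the outer side of [e], the side [v] opposite to [src
    c] crosses [c]; the flip of [v] has [src c] as an end, so it does not. *)
Lemma approaching_flip T c : flippable T -> region c -> ~ T c ->
  exists v v' e1 e2 e3 e4, [/\ T v, crossing c v, flip_quad v v' e1 e2 e3 e4,
    edges_in T e1 e2 e3 e4 & ~ crossing c v'] /\ ~ is_side v /\ ~ bridge v.
Proof.
move=> gT rc nTc; have [mx cov reg br] := gT; have ltc := chord_lt c.
pose P q := exists e, [/\ T e, ends e (src c) q & q < tgt c].
have nsc : ~ is_side c by move=> sc; apply: nTc; apply: side_in_maximal.
have [f [sf tf]] : exists f, src f = src c /\ tgt f = src c + 1 by apply: exists_chord; lia.
have [|q [e []]|q [e [Te [se te] lq]] qmax] := @int_max P (src c + 1) (tgt c).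
- exists f; split=> //; first by apply: side_in_maximal => //; rewrite /is_side /= sf.
  by move: nsc; rewrite /is_side /=; lia.
- lia.
have lte := chord_lt e.
have [|d Td cde] := cov e Te.
  by move=> [_ rf]; apply: (rc (tgt e)); [right | lia].
have key v g : T v -> T g -> crossing c v -> oriented g v e ->
    exists v v' e1 e2 e3 e4, [/\ T v, crossing c v, flip_quad v v' e1 e2 e3 e4,
      edges_in T e1 e2 e3 e4 & ~ crossing c v'] /\ ~ is_side v /\ ~ bridge v.
  move=> Tv Tg cv cyc_v.
  have nsv : ~ is_side v.
    by move: cv; rewrite /crossing /is_side /=; lia.
  have nbv : ~ bridge v.
    move=> [lf rf]; case: cv => h.
      by apply: (rc (src v)); [left | lia].
    by apply: (rc (tgt v)); [right | lia].
  have [v' [e1 [e2 [e3 [e4 [quad Te4]]]]]] := exists_flip_quad gT Tv nsv nbv.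
  exists v, v', e1, e2, e3, e4; split=> //; split=> //.
  have edge : e = e2 \/ e = e4.
    by case: (flip_quad_uniq mx.1 Tv Te4 quad Tg Te cyc_v) => -[_ ?]; [left | right].
  have [nsv1 nsv2] : src c <> src v /\ src c <> tgt v by move: cv; rewrite /crossing; lia.
  suff : src v' = src c \/ tgt v' = src c by rewrite /crossing; lia.
  move: quad => [p [q' [r [s [pq qr rs [] [? ? [? ? ? ?]]]]]]];
  by case: edge => ee; subst e; lia.
have [a [b [Ta Tb ab]]] := outer_apex mx Te Td cde.
have lta := chord_lt a; have ltb := chord_lt b.
case: ab => [[sb tb ta]|[sa ta tb]].
  have : tgt b <> tgt c.
    by move=> tbc; apply: nTc; rewrite (_ : c = b) //; apply: chord_inj; lia.
  have qb : tgt b < tgt c -> tgt b <= q by move=> lt; apply: qmax; exists b; split=> //; lia.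
  move=> ne; apply: (key a b) => //; first by left; lia.
  by apply/orientedE; lia.
apply: (key b a) => //; first by right; lia.
by apply/orientedE; lia.
Qed.

End Fountains.

(** * Seeds of Pluecker coordinates *)

Lemma fsbig_prod2 (R : comNzRingType) (V : choiceType) (f : V -> R) (u w : V) : u != w ->
  (forall z, z != u -> z != w -> f z = 1) ->
  \big[*%R/1]_(z \in [set: V]) f z = f u * f w.
Proof.
move=> uw f1; rewrite -(@fsbig_widen _ _ _ _ [set u; w]) //; last first.
  by move=> z [_ /= /not_orP [/eqP zu /eqP zw]]; apply: f1.
rewrite fsbigU0 ?fsbig_set1 //.
by move=> z [/= -> /eqP]; rewrite (negbTE uw).
Qed.

Section Seeds.
Variables (k K : fieldType) (iota : {rmorphism Gr2 k -> K}).
Hypothesis iota_inj : injective iota.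
Variable t : set chord.
Hypothesis tP : triangulation t.

Local Notation V := (tri_vertex t).
Local Notation F := (is_side `|` bridge t).
Local Notation Delta c := (iota (plucker k c)).

(** Mutation keeps the vertices of the quiver and moves the chords; [lam] is the
    current chord of each vertex. Mutation may create arrows between frozen
    vertices, so these are left unspecified; the exchange relations and the
    other arrows never depend on them. *)
Definition represents (s : seed K V) (lam : V -> chord) := [/\ injective lam,
  flippable t (range lam), forall v, cluster s v = Delta (lam v),
  forall v, frozen (quiver s) v <-> F (lam v) &
  forall u v, ~ (F (lam u) /\ F (lam v)) ->
    arrows (quiver s) u v = `[< arrow (range lam) (lam u) (lam v) >] :> nat].

Lemma range_vertex : range (val : V -> chord) = chords t.
Proof.
apply/seteqP; split=> [_ [v _ <-]|c Tc]; first by have := valP v; rewrite inE.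
by have Tc' : c \in t `|` is_side; [rewrite inE | exists (exist _ c Tc')].
Qed.

Lemma represents_initial : represents (initial_seed iota t F) val.
Proof.
have inj : injective (val : V -> chord) by exact: val_inj.
split=> //; first by rewrite range_vertex; apply: flippable_chords.
move=> u v nF /=; congr nat_of_bool; apply/asboolP/asboolP.
  move=> [[ij [jk [ik [tri h]]]] _]; case: h => -[-> ->].
  - by exists (val jk); [exists jk | apply: Or31].
  - by exists (val ij); [exists ij | apply: Or32].
  - by exists (val ik); [exists ik | apply: Or33].
move=> [_ [w _ <-] h]; split=> //; case: h => tri.
- by exists u, w, v; split=> //; apply: Or31.
- by exists w, v, u; split=> //; apply: Or32.
- by exists v, u, w; split=> //; apply: Or33.
Qed.

Lemma plucker_exchange v v' e1 e2 e3 e4 : flip_quad v v' e1 e2 e3 e4 ->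
  Delta e1 * Delta e3 + Delta e2 * Delta e4 = Delta v * Delta v'.
Proof.
have rel (p q r s : int) (pq : p < q) (qr : q < r) (rs : r < s) a1 a2 a3 a4 a5 a6 :
    ends a1 p r -> ends a2 q s -> ends a3 p q -> ends a4 r s -> ends a5 p s -> ends a6 q r ->
    Delta a1 * Delta a2 = Delta a3 * Delta a4 + Delta a5 * Delta a6.
  move=> [s1 t1] [s2 t2] [s3 t3] [s4 t4] [s5 t5] [s6 t6].
  have : \pi_{ideal_quot (@plucker_ideal k)} (plucker_relation k pq qr rs) = 0.
    by apply/plucker_pi_eq0 => S [_]; apply; exists p, q, r, s, pq, qr, rs.
  have plE := @rmorph_plucker_relation k (Gr2 k)
    (\pi_{ideal_quot (@plucker_ideal k)} : {rmorphism {malg k[{cmonom chord}]} -> Gr2 k})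
    (plucker k) _ _ _ _ pq qr rs (fun _ => erefl).
  rewrite plE => /eqP; rewrite subr_eq0 => /eqP pl.
  rewrite (_ : a1 = mkchord (lt_trans pq qr)); last exact: chord_inj.
  rewrite (_ : a2 = mkchord (lt_trans qr rs)); last exact: chord_inj.
  rewrite (_ : a3 = mkchord pq); last exact: chord_inj.
  rewrite (_ : a4 = mkchord rs); last exact: chord_inj.
  rewrite (_ : a5 = mkchord (lt_trans (lt_trans pq qr) rs)); last exact: chord_inj.
  rewrite (_ : a6 = mkchord qr); last exact: chord_inj.
  apply: etrans (esym (rmorphM iota _ _)) (etrans (congr1 iota pl) _).
  exact: etrans (rmorphD iota _ _) (congr2 +%R (rmorphM iota _ _) (rmorphM iota _ _)).
have alg1 (x x' x1 x2 x3 x4 : K) :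
    x * x' = x1 * x3 + x4 * x2 -> x1 * x3 + x2 * x4 = x * x' by move->; ring.
have alg2 (x x' x1 x2 x3 x4 : K) :
    x' * x = x4 * x2 + x3 * x1 -> x1 * x3 + x2 * x4 = x * x' by rewrite [x * x']mulrC => ->; ring.
move=> [p [q [r [s [pq qr rs [] [? ? [? ? ? ?]]]]]]].
  by apply: alg1; apply: (rel p q r s).
by apply: alg2; apply: (rel p q r s).
Qed.

Lemma plucker_neq0 a : plucker k a != 0.
Proof.
apply/eqP => a0.
have nc (u v : unit) : ~ crossing a a by rewrite /crossing; lia.
have inj : injective (fun _ : unit => a) by move=> [] [].
have ind := @plucker_alg_independent k K iota unit (fun _ => a) iota_inj inj nc << ucm tt >>.
suff /ind /eqP : mmap (iota \o Gr2_scalar (k := k)) (monomial_eval (fun _ : unit => Delta a))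
    << ucm tt >> = 0 by rewrite monalgU_eq0 oner_eq0.
by rewrite /mmap msuppU1 big_seq_fset1 monomial_evalU a0 rmorph0 mulr0.
Qed.

Lemma Delta_neq0 a : Delta a != 0.
Proof.
apply/eqP => Da; case/eqP: (plucker_neq0 a); apply: iota_inj.
by rewrite Da rmorph0.
Qed.

Definition relabel (lam : V -> chord) (v : V) v' u := if u == v then v' else lam u.

(** The exchange relation at [v] is the short Pluecker relation of the
    quadrilateral around [lam v], and the arrows change as under the flip. *)
Lemma represents_mutate s lam v v' e1 e2 e3 e4 : represents s lam ->
  ~ frozen (quiver s) v -> flip_quad (lam v) v' e1 e2 e3 e4 ->
  edges_in (range lam) e1 e2 e3 e4 ->
  represents (mutate s v) (relabel lam v v') /\
  range (relabel lam v v') = flip (range lam) (lam v) v'.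
Proof.
move=> [lam_inj gT clE frE arE] nfr quad Te.
have nF : ~ F (lam v) by move/frE.
set lam' := relabel lam v v'.
have [mx cov reg br] := gT.
have Tv : range lam (lam v) by exists v.
have nTv' := flip_notin mx Tv quad.
have range' : range lam' = flip (range lam) (lam v) v'.
  apply/seteqP; split=> [_ [u _ <-]|c [[[u _ <-] uv]|->]].
  - rewrite /lam' /relabel; case: eqP => [_|uv]; [by right | left; split; first by exists u].
    by move/lam_inj.
  - by exists u => //; rewrite /lam' /relabel; case: eqP => // eu; case: uv; rewrite eu.
  - by exists v => //; rewrite /lam' /relabel eqxx.
have lam'_inj : injective lam'.
  move=> u w; rewrite /lam' /relabel; case: eqP => [->|_]; case: eqP => [->|_] //.
  - by move=> e; case: nTv'; rewrite e; exists w.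
  - by move=> e; case: nTv'; rewrite -e; exists u.
  - exact: lam_inj.
have FT : F `<=` range lam by move=> c [sc|/br //]; apply: side_in_maximal.
have nFv' : ~ F v' by move/FT.
have toE u : arrows (quiver s) u v = (lam u == e1) || (lam u == e3) :> nat.
  rewrite arE; last by case.
  congr nat_of_bool; apply/asboolP/orP => [/(arrow_to_v mx Tv quad Te)|h].
    by case=> [|->|->]; rewrite ?eqxx; [exists u | left | right].
  by apply/(arrow_to_v mx Tv quad Te); [exists u | case: h => /eqP; [left|right]].
have ofE u : arrows (quiver s) v u = (lam u == e2) || (lam u == e4) :> nat.
  rewrite arE; last by case.
  congr nat_of_bool; apply/asboolP/orP => [/(arrow_of_v mx Tv quad Te)|h].
    by case=> [|->|->]; rewrite ?eqxx; [exists u | left | right].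
  by apply/(arrow_of_v mx Tv quad Te); [exists u | case: h => /eqP; [left|right]].
have prod2 e e' (q : V -> nat) : range lam e -> range lam e' -> e != e' ->
    (forall u, q u = (lam u == e) || (lam u == e') :> nat) ->
    \big[*%R/1]_(u \in [set: V]) cluster s u ^+ q u = Delta e * Delta e'.
  move=> [u _ eu] [u' _ eu'] ne qE.
  rewrite (@fsbig_prod2 _ _ _ u u').
  - by rewrite !qE eu eu' !eqxx orbT !expr1 !clE eu eu'.
  - by apply: contra ne => /eqP uu; rewrite -eu -eu' uu.
  - move=> z zu zu'; rewrite qE -eu -eu' !(inj_eq lam_inj) (negbTE zu) (negbTE zu').
    by rewrite expr0.
have [n13 n24] := flip_quad_neq quad.
have [T1 T2 T3 T4] := Te.
split; last exact: range'.
split; first exact: lam'_inj.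
- by rewrite range'; apply: flippable_flip Te => // bv; apply: nF; right.
- move=> u; rewrite /= /lam' /relabel; case: eqP => [_|//].
  rewrite /exchange (prod2 e1 e3) // ?(prod2 e2 e4) //; try by apply/eqP.
  rewrite (plucker_exchange quad) clE mulrC mulKf //.
  exact: Delta_neq0.
- move=> u; rewrite /= /lam' /relabel; case: eqP => [->|_]; last exact: frE.
  by split=> [/nfr|/nFv'].
- move=> u w nFuw; rewrite range' /= /mutate_arrows; move: nFuw; rewrite /lam' /relabel.
  have Tu z : range lam (lam z) by exists z.
  have T'u z : z <> v -> flip (range lam) (lam v) v' (lam z).
    by move=> zv; left; split=> // /lam_inj.
  have [Fm quadN] : maximal_nc (flip (range lam) (lam v) v') /\ v' <> lam v.
    by split; [exact: flip_maximal quad Te | move=> e; apply: nTv'; rewrite e].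
  case: (eqVneq u v) => [->|/eqP uv]; case: (eqVneq w v) => [->|/eqP wv] //= nFuw.
  + rewrite toE; congr nat_of_bool; apply/idP/asboolP; last by case=> z _ /oriented_neq.
    have [c1 c3 _ _] := flip_quad_oriented quad.
    by case/orP => /eqP e; [have := oriented_neq c1 | have := oriented_neq c3]; rewrite -e.
  + rewrite toE; congr nat_of_bool; apply/orP/asboolP => [h|].
      by apply/(flip_of_v' mx quad Te (T'u w wv)); case: h => /eqP; [left|right].
    by move/(flip_of_v' mx quad Te (T'u w wv)) => [] ->; [left|right].
  + rewrite ofE; congr nat_of_bool; apply/orP/asboolP => [h|].
      by apply/(flip_to_v' mx quad Te (T'u u uv)); case: h => /eqP; [left|right].
    by move/(flip_to_v' mx quad Te (T'u u uv)) => [] ->; [left|right].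
  rewrite (flip_arrow_mutation mx Tv quad Te (Tu u) (Tu w)); [|by move/lam_inj|by move/lam_inj].
  rewrite !arE //; try by case.
  by case=> ? ?; apply: nFuw.
Qed.

End Seeds.

(** * The cluster structure of a triangulation *)

Lemma subsingleton_finite (X : Type) (A : set X) :
  (forall x y, A x -> A y -> x = y) -> finite_set A.
Proof.
move=> uniq; case: (pselect (exists x, A x)) => [[x Ax]|nex].
  apply: (@sub_finite_set _ _ [set x]); last exact: finite_set1.
  by move=> y Ay; apply: uniq.
apply: (@sub_finite_set _ _ set0); last exact: finite_set0.
by move=> y Ay; case: nex; exists y.
Qed.

(** In a noncrossing set, at most one triangle contains [v] as its long, at most
    one as its left and at most one as its right side. *)
Lemma finite_triangles T v : (forall c d, T c -> T d -> ~ crossing c d) ->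
  finite_set [set p : chord * chord | [/\ T p.1, T p.2 & oriented p.1 v p.2]].
Proof.
move=> nc; pose P (R : chord -> chord -> Prop) :=
  [set p : chord * chord | [/\ T p.1, T p.2 & R p.1 p.2]].
have fin R : (forall a b a' b', T a -> T b -> T a' -> T b' -> R a b -> R a' b' ->
    (src a = src a' /\ tgt a = tgt a') /\ (src b = src b' /\ tgt b = tgt b')) -> finite_set (P R).
  move=> uniq; apply: subsingleton_finite => -[a b] [a' b'] [/= Ta Tb Rab] [/= Ta' Tb' Rab'].
  have [[sa ta] [sb tb]] := uniq a b a' b' Ta Tb Ta' Tb' Rab Rab'.
  by congr pair; apply: chord_inj.
apply: (@sub_finite_set _ _ (P (fun a b => src a = src v /\ tgt a = src b /\ tgt b = tgt v) `|`
  P (fun a b => src b = src a /\ tgt b = src v /\ tgt v = tgt a) `|`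
  P (fun a b => src v = src b /\ tgt v = src a /\ tgt a = tgt b))).
  move=> [a b] [/= Ta Tb /orientedE [|[]] h]; by [left; left | left; right | right].
rewrite !finite_setU; split; first split.
all: apply: fin => a b a' b' Ta Tb Ta' Tb' [? [? ?]] [? [? ?]].
all: have := chord_lt a; have := chord_lt b; have := chord_lt a'; have := chord_lt b'.
all: have := chord_lt v; have := nc _ _ Ta Tb'; have := nc _ _ Ta' Tb; rewrite /crossing; lia.
Qed.

Lemma Gr2_scalar1 (k : fieldType) : @Gr2_scalar k 1 = 1.
Proof. by rewrite /Gr2_scalar mpolyC1E (rmorph1 \pi_{ideal_quot (@plucker_ideal k)}). Qed.

Lemma Gr2_scalar0 (k : fieldType) : @Gr2_scalar k 0 = 0.
Proof. by rewrite /Gr2_scalar malgC0E (rmorph0 \pi_{ideal_quot (@plucker_ideal k)}). Qed.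

Section ClusterStructure.
Variables (k K : fieldType) (iota : {rmorphism Gr2 k -> K}).
Hypothesis iota_inj : injective iota.
Variable t : set chord.
Hypothesis tP : triangulation t.

Local Notation V := (tri_vertex t).
Local Notation F := (is_side `|` bridge t).
Local Notation Delta c := (iota (plucker k c)).
Local Notation s0 := (initial_seed iota t F).
Local Notation scalar := (iota \o @Gr2_scalar k).
Local Notation S := (plucker_subalgebra k (region t)).

Lemma represents_mutation_equivalent s : mutation_equivalent s0 s ->
  exists lam, represents iota s lam.
Proof.
elim=> [|{}s v _ [lam rep] nfr]; first by exists val; apply: represents_initial.
have [_ gT _ frE _] := rep.
have nF : ~ F (lam v) by move/frE.
have [|||v' [e1 [e2 [e3 [e4 [quad Te]]]]]] := @exists_flip_quad t _ (lam v) gT.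
- by exists v.
- by move=> sv; apply: nF; left.
- by move=> bv; apply: nF; right.
by exists (relabel lam v v'); have [] := represents_mutate iota_inj rep nfr quad Te.
Qed.

(** Induction on a bound for the number of chords crossing [c]: an approaching
    flip removes one of them and adds none. *)
Lemma cluster_variable_reach c : region t c -> cluster_variables s0 (Delta c).
Proof.
move=> rc; have [l lP] := finite_crossing rc.
have found s lam : mutation_equivalent s0 s -> represents iota s lam -> range lam c ->
    cluster_variables s0 (Delta c).
  move=> eqs [_ _ clE _ _] [u _ <-]; exists s; first exact: eqs.
  by rewrite -clE; exists u.
suff H n : forall s lam (r : seq chord), mutation_equivalent s0 s -> represents iota s lam ->
    (size r <= n)%N -> (forall d, range lam d -> crossing c d -> d \in r) ->
    cluster_variables s0 (Delta c).
  apply: (H _ s0 val l _ _ (leqnn _)); first exact: MutationRefl.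
    exact: represents_initial.
  by rewrite range_vertex.
elim: n => [|n IH] s lam r eqs rep le cr.
  have [_ [mx _ _ _] clE _ _] := rep.
  apply: (found s lam eqs rep); apply: mx.2 => d Td /(cr d Td); by case: r le {cr}.
have [_ gT clE frE _] := rep.
case: (pselect (range lam c)) => [|nTc]; first exact: found eqs rep.
have [v [v' [e1 [e2 [e3 [e4 [[[u _ uv] cv quad Te ncv'] [nsv nbv]]]]]]]] :=
  approaching_flip gT rc nTc.
rewrite -uv in cv quad nsv nbv.
have nfr : ~ frozen (quiver s) u by move/frE => [].
have [rep' range'] := represents_mutate iota_inj rep nfr quad Te.
have vr : lam u \in r by apply: cr => //; exists u.
apply: (IH (mutate s u) _ (rem (lam u) r) _ rep').
- exact: MutationStep.
- by rewrite size_rem //; case: (size r) le.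
rewrite range' => d [[Td dv]|->] // cd.
by apply: rem_mem; [apply/eqP | apply: cr].
Qed.

Lemma cluster_variablesE :
  cluster_variables s0 = [set Delta c | c in region t].
Proof.
apply/seteqP; split=> [z [s eqs [u _ <-]]|_ [c rc <-]]; last exact: cluster_variable_reach.
have [lam [_ [_ _ reg _] clE _ _]] := represents_mutation_equivalent eqs.
by exists (lam u); [apply: reg; exists u | rewrite clE].
Qed.

Lemma gen_is_subalgebra (B : comNzRingType) (f : k -> B) (G : set B) :
  is_subalgebra f (gen_subalgebra f G).
Proof.
split=> [a|x y Sx Sy|x y Sx Sy] A AP; have [[Ac AD AM] _] := AP; first exact: Ac.
- by apply: AD; [apply: Sx | apply: Sy].
- by apply: AM; [apply: Sx | apply: Sy].
Qed.

Lemma gen_subfield_is_subfield (f : k -> K) (G : set K) : is_subfield f (gen_subfield f G).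
Proof.
split; last by move=> x Sx A AP; have [[_ AV] _] := AP; apply: AV; apply: Sx.
split=> [a|x y Sx Sy|x y Sx Sy] A AP; have [[[Ac AD AM] _] _] := AP; first exact: Ac.
- by apply: AD; [apply: Sx | apply: Sy].
- by apply: AM; [apply: Sx | apply: Sy].
Qed.

Lemma cluster_algebraE : cluster_algebra scalar s0 = iota @` S.
Proof.
rewrite /cluster_algebra cluster_variablesE; apply/seteqP; split.
  move=> z /(_ (iota @` S)); apply; split.
    have [Sc SD SM] := gen_is_subalgebra (@Gr2_scalar k) (plucker k @` region t).
    split=> [a|_ _ [x Sx <-] [y Sy <-]|_ _ [x Sx <-] [y Sy <-]].
    - by exists (Gr2_scalar a); [exact: Sc|].
    - by exists (x + y); [apply: SD | rewrite rmorphD].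
    - by exists (x * y); [apply: SM | rewrite rmorphM].
  by move=> _ [c rc <-]; exists (plucker k c) => // A [_]; apply; exists c.
move=> _ [x Sx <-]; set G := [set _ | _ in _].
have [Gc GD GM] := gen_is_subalgebra scalar G.
apply: (Sx (iota @^-1` gen_subalgebra scalar G)); split.
  split=> [a|y z|y z] /=; first exact: Gc.
  - by rewrite rmorphD; apply: GD.
  - by rewrite rmorphM; apply: GM.
by move=> _ [c rc <-] A [_]; apply; exists c.
Qed.

Lemma exchange_quiver_ice : is_ice_quiver (exchange_quiver t F).
Proof.
have mx := triangulation_maximal tP.
have arrowP (u v : V) : arrows (exchange_quiver t F) u v != 0%N ->
    exists2 w : V, True & oriented (val u) (val v) (val w).
  rewrite /=; case: asboolP => // -[[ij [jk [ik [tri h]]]] _] _.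
  case: h => -[-> ->].
  - by exists jk => //; apply: Or31.
  - by exists ij => //; apply: Or32.
  - by exists ik => //; apply: Or33.
have Tval (u : V) : chords t (val u) by have := valP u; rewrite inE.
split=> [v|u v|v].
- by apply/eqP; apply: contrapT => /negP /arrowP [w _ /oriented_neq].
- case: (eqVneq (arrows (exchange_quiver t F) u v) 0%N) => [|/arrowP [w _ cw]]; first by left.
  right; apply/eqP; apply: contrapT => /negP /arrowP [w' _]; exact: oriented_antisym cw.
have fin := finite_triangles (val v) mx.1.
apply: (@sub_finite_set _ _ ((val : V -> chord) @^-1` ((fst @` [set p : chord * chord |
    [/\ chords t p.1, chords t p.2 & oriented p.1 (val v) p.2]]) `|`
  (snd @` [set p : chord * chord |
    [/\ chords t p.1, chords t p.2 & oriented p.1 (val v) p.2]])))).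
  move=> u [] /arrowP [w _ cw]; [left | right].
    by exists (val u, val w) => //; split=> //=; apply: Tval.
  exists (val w, val u) => //; split=> /=; [exact: Tval|exact: Tval|].
  exact/oriented_rot/oriented_rot.
apply: finite_preimage; first by move=> a b _ _; apply: val_inj.
by rewrite finite_setU; split; apply: finite_image.
Qed.

Lemma cluster_variables_subfield s : mutation_equivalent s0 s ->
  forall u, gen_subfield scalar (range (cluster s0)) (cluster s u).
Proof.
have [[Kc KD KM] KV] := gen_subfield_is_subfield scalar (range (cluster s0)).
have K1 : gen_subfield scalar (range (cluster s0)) 1.
  by have := Kc 1; rewrite /comp Gr2_scalar1 rmorph1.
elim=> [u|{}s v _ IH _ u]; first by move=> A [_]; apply; exists u.
rewrite /=; case: eqP => // _; rewrite /exchange.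
have Kprod (q : V -> nat) : gen_subfield scalar (range (cluster s0))
    (\big[*%R/1]_(z \in [set: V]) cluster s z ^+ q z).
  apply: (big_ind _ K1 KM) => z _; elim: (q z) => [|n IHn]; first by rewrite expr0.
  by rewrite exprS; apply: KM.
by apply: KM; [apply: KD; apply: Kprod | apply: KV].
Qed.

Lemma sub_fraction_is_subfield :
  is_subfield scalar (sub_fraction_field iota S).
Proof.
have [Sc SD SM] := gen_is_subalgebra (@Gr2_scalar k) (plucker k @` region t).
have S1 : S 1 by have := Sc 1; rewrite Gr2_scalar1.
have iota0 (b : Gr2 k) : b != 0 -> iota b != 0.
  by move=> b0; apply/eqP => ib; case/eqP: b0; apply: iota_inj; rewrite ib rmorph0.
have S0 : S 0 by have := Sc 0; rewrite Gr2_scalar0.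
have mul0 (b d : Gr2 k) : b != 0 -> d != 0 -> b * d != 0.
  move=> b0 d0; apply/eqP => bd; have := mulf_neq0 (iota0 _ b0) (iota0 _ d0).
  by rewrite -rmorphM bd rmorph0 eqxx.
have iotaM x y : iota x * iota y = iota (x * y) := esym (rmorphM iota x y).
have mem (a b : Gr2 k) z : S a -> S b -> b != 0 -> z = iota a / iota b ->
    sub_fraction_field iota S z.
  by move=> Sa Sb b0 ez; exists a, b.
split; last first.
  move=> _ [a [b [Sa Sb b0 ->]]]; case: (eqVneq a 0) => [a0|a0].
    apply: (mem 0 1 _ S0 S1 (oner_neq0 _)).
    by rewrite a0 (rmorph0 iota) !mul0r invr0.
  by apply: (mem b a _ Sb Sa a0); apply: invf_div.
split=> [x|_ _ [a [b [Sa Sb b0 ->]]] [c [d [Sc' Sd d0 ->]]]|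
  _ _ [a [b [Sa Sb b0 ->]]] [c [d [Sc' Sd d0 ->]]]].
- by apply: (mem (Gr2_scalar x) 1 _ (Sc x) S1 (oner_neq0 _)); rewrite (rmorph1 iota) divr1.
- apply: (mem (a * d + c * b) (b * d) _ _ (SM _ _ Sb Sd) (mul0 _ _ b0 d0)).
    exact: SD (SM _ _ Sa Sd) (SM _ _ Sc' Sb).
  apply: etrans (addf_div _ _ (iota0 _ b0) (iota0 _ d0)) _.
  apply: (congr2 (fun x y => x / y)); last exact: iotaM.
  exact: etrans (congr2 +%R (iotaM _ _) (iotaM _ _)) (esym (rmorphD iota _ _)).
- apply: (mem (a * c) (b * d) _ (SM _ _ Sa Sc') (SM _ _ Sb Sd) (mul0 _ _ b0 d0)).
  exact: etrans (mulf_div _ _ _ _) (congr2 (fun x y => x / y) (iotaM _ _) (iotaM _ _)).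
Qed.

(** The algebra [S] is generated by cluster variables, and these are obtained
    from the initial cluster by field operations. *)
Lemma gen_subfield_initial :
  gen_subfield scalar (range (cluster s0)) = sub_fraction_field iota S.
Proof.
have [mx cov reg br] := flippable_chords tP.
apply/seteqP; split.
  move=> z /(_ (sub_fraction_field iota S)); apply; split; first exact: sub_fraction_is_subfield.
  have [Sc _ _] := gen_is_subalgebra (@Gr2_scalar k) (plucker k @` region t).
  have S1 := Sc 1; rewrite Gr2_scalar1 in S1.
  move=> _ [u _ <-] /=; exists (plucker k (val u)), 1; split.
  - move=> A [_]; apply; exists (val u) => //; apply: reg.
    by have := valP u; rewrite inE.
  - exact: S1.
  - exact: oner_neq0.
  - by rewrite (rmorph1 iota) divr1.
have Ksub := gen_subfield_is_subfield scalar (range (cluster s0)).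
have iS x : S x -> gen_subfield scalar (range (cluster s0)) (iota x).
  move=> Sx; have : (iota @` S) (iota x) by exists x.
  rewrite -cluster_algebraE => /(_ (gen_subfield scalar (range (cluster s0)))); apply.
  split; first exact: Ksub.1.
  by move=> z [s eqs [u _ <-]]; apply: cluster_variables_subfield.
move=> _ [a [b [Sa Sb b0 ->]]]; have [[_ _ KM] KV] := Ksub.
exact: KM (iS _ Sa) (KV _ (iS _ Sb)).
Qed.

End ClusterStructure.

Theorem triangulation_cluster_structure (k : fieldType) (t : set chord) : triangulation t ->
  yields_cluster_structure t (is_side `|` bridge t) (plucker_subalgebra k (region t)).
Proof.
move=> tP; have [K [iota [iota_inj iota_frac]]] := domain_fraction_field (@Gr2_domain k).
exists K, iota; split=> //.
  split; first exact: exchange_quiver_ice.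
    have vertex_inj : injective (val : tri_vertex t -> chord) by exact: val_inj.
    apply: (plucker_alg_independent iota_inj vertex_inj) => u v.
    apply: (triangulation_maximal tP).1.
      by have := valP u; rewrite inE.
    by have := valP v; rewrite inE.
  exact: gen_subfield_initial.
exact: cluster_algebraE.
Qed.

(** * The three kinds of triangulation *)

Lemma noncrossing_triangulation t a b : triangulation t -> t a -> t b -> ~ crossing a b.
Proof. by case=> -[_ nc] _; apply: nc. Qed.

Lemma left_fountain_unique t m n : triangulation t ->
  left_fountain t m -> left_fountain t n -> m = n.
Proof.
move=> tP; wlog lt : m n / m < n.
  by move=> H lm ln; case: (ltgtP m n) => // h; [apply: H | apply/esym/H].
move=> /left_fountainP lm /left_fountainP ln; exfalso.
have [a [ta ea la]] := ln m; have [b [tb eb lb]] := lm (src a).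
by apply: (noncrossing_triangulation tP tb ta); left; lia.
Qed.

Lemma right_fountain_unique t m n : triangulation t ->
  right_fountain t m -> right_fountain t n -> m = n.
Proof.
move=> tP; wlog lt : m n / m < n.
  by move=> H lm ln; case: (ltgtP m n) => // h; [apply: H | apply/esym/H].
move=> /right_fountainP rm /right_fountainP rn; exfalso.
have [a [ta ea la]] := rm n; have [b [tb eb lb]] := rn (tgt a).
by apply: (noncrossing_triangulation tP ta tb); left; lia.
Qed.

Lemma split_fountain_lt t l r : triangulation t ->
  left_fountain t l -> right_fountain t r -> l <> r -> l < r.
Proof.
move=> tP /left_fountainP lf /right_fountainP rf ne.
case: (ltgtP l r) => // lt; exfalso.
have [a [ta ea la]] := lf r; have [b [tb eb lb]] := rf l.
by apply: (noncrossing_triangulation tP ta tb); left; lia.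
Qed.

Lemma locally_finite_no_fountain t m : locally_finite t -> ~ fountain_vertex t m.
Proof.
move=> lf; have fin := lf m.
by case; apply; apply: sub_finite_set fin => a [ta e]; split=> //; [right | left].
Qed.

Theorem theorem3p16 (R : realType) (t : set chord) (tP : triangulation t) :
  (locally_finite t ->
     yields_cluster_structure t is_side [set: Gr2 R[i]]) /\
  (forall k : int, fountain t k ->
     yields_cluster_structure t is_side
       (plucker_subalgebra R[i] [set a | tgt a <= k \/ k <= src a])) /\
  (forall l r : int, left_fountain t l -> right_fountain t r -> l <> r ->
     yields_cluster_structure t
       (is_side `|` [set a | src a = l /\ tgt a = r])
       (plucker_subalgebra R[i]
          [set a | [\/ tgt a <= l, l <= src a /\ tgt a <= r | r <= src a]])).
Proof.
have main := triangulation_cluster_structure R[i] tP.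
split=> [lf|]; last split=> [k [lk rk]|l r ll rr ne].
- have bridge0 : bridge t = set0.
    apply/seteqP; split=> // c [lc _].
    by apply: (locally_finite_no_fountain (m := src c) lf); left.
  have regionT : region t = setT.
    by apply/seteqP; split=> // c _ m /(locally_finite_no_fountain lf).
  by move: main; rewrite bridge0 setU0 regionT gen_plucker_all.
- have fountain_k m : fountain_vertex t m -> m = k.
    by case=> [/(left_fountain_unique tP)|/(right_fountain_unique tP)]; apply.
  have bridge0 : bridge t = set0.
    apply/seteqP; split=> // c [lc rc].
    have [sc tc] : src c = k /\ tgt c = k by split; apply: fountain_k; [left | right].
    by have := chord_lt c; lia.
  have regionE : region t = [set a | tgt a <= k \/ k <= src a].
    apply/seteqP; split=> c /= rc; last by move=> m /fountain_k ->; lia.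
    by have := rc k (or_introl lk); lia.
  by move: main; rewrite bridge0 setU0 regionE.
- have lr := split_fountain_lt tP ll rr ne.
  have fountain_lr m : fountain_vertex t m -> m = l \/ m = r.
    by case=> h; [left; apply: left_fountain_unique ll | right; apply: right_fountain_unique rr].
  have bridgeE : bridge t = [set a | src a = l /\ tgt a = r].
    apply/seteqP; split=> c /= [h1 h2].
      by split; [apply: left_fountain_unique ll | apply: right_fountain_unique rr].
    by split; rewrite ?h1 ?h2.
  have regionE : region t = [set a | [\/ tgt a <= l, l <= src a /\ tgt a <= r | r <= src a]].
    apply/seteqP; split=> c /= rc.
      have := rc l (or_introl ll); have := rc r (or_intror rr).
      move=> nr nl; have := chord_lt c.
      case: (leP (tgt c) l) => [cl _|cl ltc]; first exact: Or31.
      case: (leP r (src c)) => [cr|cr]; first exact: Or33.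
      by apply: Or32; lia.
    by move=> m /fountain_lr em; case: rc em; lia.
  by move: main; rewrite bridgeE regionE.
Qed.
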